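(* If $\xi=(p:E\to B)$ is a fibration, then the map of simplicial sets $k:d(N_fE)\to NE$ is a weak equivalence.
   Context: All categories are small. For a functor $p:E\to B$, an arrow $f:e\to e'$ of $E$ is cartesian if for every $g:e\to e''$ with $p(g)=p(f)$ there is a unique $h:e'\to e''$ with $p(h)=\mathrm{id}_{p(e')}$ and $hf=g$. The functor $p$ is a prefibration if for every object $e$ of $E$ and every arrow $\phi:p(e)\to b$ of $B$ there is a cartesian arrow with domain $e$ lying over $\phi$; it is a fibration if moreover cartesian arrows are closed under composition. (So ''fibration'' means what is usually called a cofibred category.) A fibred map $(f,g):\xi\to\xi'$ between fibrations $p:E\to B$, $p':E'\to B'$ is a pair of functors $f:E\to E'$, $g:B\to B'$ with $p'f=gp$ and $f$ preserving cartesian arrows; the set of these is $\mathrm{Fib}(\xi,\xi')$. Let $\underline n=\{0<\dots<n\}$, viewed as a category, and let $\square_{m,n}$ be the fibration $\mathrm{pr}_2:\underline m\times\underline n\to\underline n$; this is functorial in $(m,n)\in\Delta\times\Delta$. The fibred nerve $N_fE=N_f\xi$ is the bisimplicial set $(N_f\xi)_{m,n}=\mathrm{Fib}(\square_{m,n},\xi)$, with structure maps given by precomposition. $d(K)$ denotes the diagonal simplicial set of a bisimplicial set $K$, and $NE$ the usual nerve of $E$. The natural map $k:d(N_fE)\to NE$ sends $s=(s_0,s_1)\in \mathrm{Fib}(\square_{n,n},\xi)$, where $s_0:\underline n\times\underline n\to E$ and $s_1:\underline n\to B$, to the $n$-simplex $s_0\circ\mathrm{diag}:\underline n\to E$, i.e.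 to $s_0(0,0)\to s_0(1,1)\to\dots\to s_0(n,n)$. A map of simplicial sets is a weak equivalence if its geometric realization is a homotopy equivalence. *)

(* Defs.v *)
From HB Require Import structures.
From mathcomp Require Import all_boot all_order all_algebra generic_quotient.
From mathcomp Require Import all_classical all_reals all_analysis.
From Stdlib Require Import Relation_Operators.

Set Implicit Arguments.
Unset Strict Implicit.
Unset Printing Implicit Defensive.

Import Order.TTheory GRing.Theory Num.Theory.
Import numFieldNormedType.Exports.

Local Open Scope classical_set_scope.
Local Open Scope ring_scope.

Local Obligation Tactic := idtac.

Record category := Category {
  ob :> Type;
  Hom : ob -> ob -> Type;
  idc : forall a, Hom a a;
  compm : forall a b c, Hom b c -> Hom a b -> Hom a c;
  compm1 : forall a b (f : Hom a b), compm f (idc a) = f;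
  comp1m : forall a b (f : Hom a b), compm (idc b) f = f;
  compmA : forall a b c d (h : Hom c d) (g : Hom b c) (f : Hom a b),
    compm h (compm g f) = compm (compm h g) f
}.
Arguments Hom {c} _ _ : rename.
Arguments idc {c} a : rename.
Arguments compm {c a b} {c'} _ _ : rename.

Notation "g \oc f" := (compm g f) (at level 40, left associativity).

(** Equality of [Arrow f] and [Arrow g] is equality of arrows of [C], including
    equality of their sources and targets, for [f] and [g] in hom-types that
    need not be convertible. *)
Record arr (C : category) := Arrow {
  source : C;
  target : C;
  mor : Hom source target
}.
Arguments Arrow {C source target} mor.

Record functor (C D : category) := Functor {
  fob :> C -> D;
  fmor : forall a b, Hom a b -> Hom (fob a) (fob b);
  fmor1 : forall a, fmor (idc a) = idc (fob a);
  fmorM : forall a b c (g : Hom b c) (f : Hom a b),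
    fmor (g \oc f) = fmor g \oc fmor f
}.
Arguments fmor {C D} f {a b} _ : rename.

Lemma functor_eq (C D : category) (o : C -> D)
    (m m' : forall a b, Hom a b -> Hom (o a) (o b)) i i' c c' :
  (forall a b (f : Hom a b), m a b f = m' a b f) ->
  @Functor C D o m i c = @Functor C D o m' i' c'.
Proof.
move=> mm'; have {}mm' : m = m'.
  by apply/functional_extensionality_dep => a;
    apply/functional_extensionality_dep => b;
    apply/functional_extensionality_dep => f.
by rewrite -{}mm' in i' c' *; congr Functor; exact: Prop_irrelevance.
Qed.

Lemma Arrow_inj (C : category) (a b : C) (f g : Hom a b) :
  Arrow f = Arrow g -> f = g.
Proof.
pose cast (u : arr C) (sa : source u = a) (tb : target u = b) : Hom a b :=
  eq_rect _ (fun c => Hom c b) (eq_rect _ (Hom (source u)) (mor u) _ tb) _ sa.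
move=> fg; suff cst u (e : u = Arrow g) sa tb : @cast u sa tb = g.
  exact: (cst _ fg erefl erefl).
by subst u; rewrite (Prop_irrelevance sa erefl) (Prop_irrelevance tb erefl).
Qed.

Lemma functor_arrow_eq (C D : category) (F G : functor C D) :
  (forall a b (f : Hom a b), Arrow (fmor F f) = Arrow (fmor G f)) -> F = G.
Proof.
move=> FG; have FGob : fob F = fob G.
  by apply/funext => a; exact: (congr1 (@source _) (FG _ _ (idc a))).
case: F G FG FGob => [u m i c] [u' m' i' c'] /= FG uu'; subst u'.
by apply: functor_eq => a b f; exact: Arrow_inj (FG _ _ _).
Qed.

Definition id_functor (C : category) : functor C C :=
  @Functor C C id (fun a b f => f) (fun=> erefl) (fun _ _ _ _ _ => erefl).

Program Definition comp_functor (C D E : category)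
    (G : functor D E) (F : functor C D) : functor C E :=
  @Functor C E (fun a => G (F a)) (fun a b f => fmor G (fmor F f)) _ _.
Next Obligation. by move=> C D E G F a; rewrite /= !fmor1. Qed.
Next Obligation. by move=> C D E G F a b c g f; rewrite /= !fmorM. Qed.

Notation "G \oF F" := (comp_functor G F) (at level 40, left associativity).

Lemma comp_functor1 (C D : category) (F : functor C D) :
  F \oF id_functor C = F.
Proof. by case: F => *; exact: functor_eq. Qed.

Lemma comp_functorA (A B C D : category)
    (H : functor C D) (G : functor B C) (F : functor A B) :
  H \oF (G \oF F) = H \oF G \oF F.
Proof. exact: functor_eq. Qed.

Program Definition prod_cat (C D : category) : category :=
  @Category (C * D)%type (fun x y => (Hom x.1 y.1 * Hom x.2 y.2)%type)
    (fun x => (idc x.1, idc x.2))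
    (fun x y z g f => (g.1 \oc f.1, g.2 \oc f.2)) _ _ _.
Next Obligation. by move=> C D x y [f g]; rewrite /= !compm1. Qed.
Next Obligation. by move=> C D x y [f g]; rewrite /= !comp1m. Qed.
Next Obligation. by move=> C D x y z t h g f; rewrite /= !compmA. Qed.

Definition pr2_functor (C D : category) : functor (prod_cat C D) D :=
  @Functor (prod_cat C D) D snd (fun x y f => f.2)
    (fun=> erefl) (fun _ _ _ _ _ => erefl).

Definition diag_functor (C : category) : functor C (prod_cat C C) :=
  @Functor C (prod_cat C C) (fun a => (a, a)) (fun a b f => (f, f))
    (fun=> erefl) (fun _ _ _ _ _ => erefl).

Program Definition prod_functor (C D C' D' : category)
    (F : functor C C') (G : functor D D') :
    functor (prod_cat C D) (prod_cat C' D') :=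
  @Functor (prod_cat C D) (prod_cat C' D') (fun x => (F x.1, G x.2))
    (fun x y f => (fmor F f.1, fmor G f.2)) _ _.
Next Obligation. by move=> C D C' D' F G x; rewrite /= !fmor1. Qed.
Next Obligation. by move=> C D C' D' F G x y z g f; rewrite /= !fmorM. Qed.

Lemma prod_functor1 (C D : category) :
  prod_functor (id_functor C) (id_functor D) = id_functor (prod_cat C D).
Proof. by apply: functor_arrow_eq => -[a b] [a' b'] [f g]. Qed.

Lemma prod_functorM (C D C' D' C'' D'' : category)
    (F' : functor C' C'') (F : functor C C')
    (G' : functor D' D'') (G : functor D D') :
  prod_functor (F' \oF F) (G' \oF G) = prod_functor F' G' \oF prod_functor F G.
Proof. exact: functor_eq. Qed.

Definition poset_cat d (T : porderType d) : category :=
  @Category T (fun x y => (x <= y)%O) (fun x => lexx x)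
    (fun x y z yz xy => le_trans xy yz)
    (fun _ _ _ => bool_irrelevance _ _) (fun _ _ _ => bool_irrelevance _ _)
    (fun _ _ _ _ _ _ _ => bool_irrelevance _ _).

Definition poset_functor d d' (T : porderType d) (T' : porderType d')
    (f : {omorphism T -> T'}) : functor (poset_cat T) (poset_cat T') :=
  @Functor (poset_cat T) (poset_cat T') f (fun x y xy => omorph_le f xy)
    (fun _ => bool_irrelevance _ _) (fun _ _ _ _ _ => bool_irrelevance _ _).

(** Arrows are lifted from their source: a fibration in the sense below is what
    is often called a cofibred category (an opfibration). *)
Definition cartesian (E B : category) (p : functor E B) (e e' : E)
    (f : Hom e e') : Prop :=
  forall (e'' : E) (g : Hom e e''), Arrow (fmor p g) = Arrow (fmor p f) ->
  exists! h : Hom e' e'',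
    Arrow (fmor p h) = Arrow (idc (p e')) /\ h \oc f = g.

Definition prefibration (E B : category) (p : functor E B) : Prop :=
  forall (e : E) (b : B) (phi : Hom (p e) b),
  exists (e' : E) (f : Hom e e'), cartesian p f /\ Arrow (fmor p f) = Arrow phi.

Definition is_fibration (E B : category) (p : functor E B) : Prop :=
  prefibration p /\
  forall (e e' e'' : E) (g : Hom e' e'') (f : Hom e e'),
    cartesian p g -> cartesian p f -> cartesian p (g \oc f).

Record fibration := Fibration {
  tot_cat : category;
  base_cat : category;
  fib_proj : functor tot_cat base_cat;
  fib_projP : is_fibration fib_proj
}.
Arguments Fibration {tot_cat base_cat fib_proj} fib_projP.

Record fibred_map (xi xi' : fibration) := FibredMap {
  fm_total : functor (tot_cat xi) (tot_cat xi');
  fm_base : functor (base_cat xi) (base_cat xi');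
  fm_comm : fib_proj xi' \oF fm_total = fm_base \oF fib_proj xi;
  fm_cart : forall (e e' : tot_cat xi) (f : Hom e e'),
    cartesian (fib_proj xi) f -> cartesian (fib_proj xi') (fmor fm_total f)
}.

Lemma fibred_map_eq (xi xi' : fibration) (s t : fibred_map xi xi') :
  fm_total s = fm_total t -> fm_base s = fm_base t -> s = t.
Proof.
case: s t => [f g c k] [f' g' c' k'] /= ff' gg'.
by rewrite -{}ff' -{}gg' in c' k' *; congr FibredMap; exact: Prop_irrelevance.
Qed.

Program Definition comp_fibred (xi xi' xi'' : fibration)
    (t : fibred_map xi' xi'') (s : fibred_map xi xi') : fibred_map xi xi'' :=
  @FibredMap xi xi'' (fm_total t \oF fm_total s)
    (fm_base t \oF fm_base s) _ _.
Next Obligation.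
move=> xi xi' xi'' t s.
by rewrite comp_functorA fm_comm -comp_functorA fm_comm comp_functorA.
Qed.
Next Obligation.
by move=> xi xi' xi'' t s e e' f cf; apply/fm_cart/fm_cart.
Qed.

Record presheaf (C : category) := Presheaf {
  sections :> C -> Type;
  restr : forall a b, Hom a b -> sections b -> sections a;
  restr1 : forall a x, restr (idc a) x = x;
  restrM : forall a b c (g : Hom b c) (f : Hom a b) x,
    restr (g \oc f) x = restr f (restr g x)
}.
Arguments restr {C} p {a b} _ _ : rename.

Record presheaf_map (C : category) (X Y : presheaf C) := PresheafMap {
  component :> forall a, X a -> Y a;
  naturality : forall a b (f : Hom a b) x,
    component (restr X f x) = restr Y f (component x)
}.

Program Definition pull_presheaf (C D : category) (F : functor C D)
    (X : presheaf D) : presheaf C :=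
  @Presheaf C (fun a => X (F a)) (fun a b f => restr X (fmor F f)) _ _.
Next Obligation. by move=> C D F X a x; rewrite /= fmor1 restr1. Qed.
Next Obligation. by move=> C D F X a b c g f x; rewrite /= fmorM restrM. Qed.

Lemma omorphism_eq d d' (T : porderType d) (T' : porderType d')
    (f g : {omorphism T -> T'}) : f =1 g -> f = g.
Proof.
case: f g => [f [[cf]]] [g [[cg]]] /= /funext fg; subst g.
by rewrite (Prop_irrelevance cf cg).
Qed.

(** The object [n] of [Delta] is the ordinal {0 < ... < n}. *)
Program Definition Delta : category :=
  @Category nat (fun m n => {omorphism 'I_m.+1 -> 'I_n.+1})
    (fun n => idfun) (fun m n p g f => g \o f) _ _ _.
Next Obligation. by move=> m n f; exact: omorphism_eq. Qed.
Next Obligation. by move=> m n f; exact: omorphism_eq. Qed.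
Next Obligation. by move=> m n p q h g f; exact: omorphism_eq. Qed.

Definition ord_cat (n : Delta) : category := poset_cat 'I_n.+1.

Definition ord_functor (m n : Delta) (a : Hom m n) :
  functor (ord_cat m) (ord_cat n) := poset_functor a.

Lemma ord_functor1 (n : Delta) : ord_functor (idc n) = id_functor (ord_cat n).
Proof. by apply: functor_eq => i j ij; exact: bool_irrelevance. Qed.

Lemma ord_functorM (m n p : Delta) (b : Hom n p) (a : Hom m n) :
  ord_functor (b \oc a) = ord_functor b \oF ord_functor a.
Proof. by apply: functor_eq => i j ij; exact: bool_irrelevance. Qed.

Definition sset := presheaf Delta.
Definition bisset := presheaf (prod_cat Delta Delta).

Definition diag_sset (K : bisset) : sset := pull_presheaf (diag_functor Delta) K.

Program Definition nerve (C : category) : sset :=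
  @Presheaf Delta (fun n => functor (ord_cat n) C)
    (fun m n a s => s \oF ord_functor a) _ _.
Next Obligation. by move=> C n s; rewrite /= ord_functor1 comp_functor1. Qed.
Next Obligation.
by move=> C m n p b a s; rewrite /= ord_functorM comp_functorA.
Qed.

Section square_fib.
Context d d' (P : porderType d) (Q : porderType d').
Let PQ := prod_cat (poset_cat P) (poset_cat Q).
Let pr2 : functor PQ (poset_cat Q) := pr2_functor (poset_cat P) (poset_cat Q).

Lemma cartesian_pr2 (x y : PQ) (f : Hom x y) : cartesian pr2 f <-> x.1 = y.1.
Proof.
case: x y f => [i j] [i' j'] [/= ii' jj']; split=> [cf|ei z [g1 g2] eg].
  pose g : @Hom PQ (i, j) (i, j') := (lexx i, jj').
  have [[h1 h2] _] := cf (i, j') g erefl.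
  by apply: le_anti; rewrite ii'; exact: h1.
case: z g1 g2 eg => [k l] /= g1 g2 eg.
have el : l = j' := congr1 (@target _) eg.
subst i' l; exists (g1, lexx j'); split=> [|[h1 h2] _].
  by split => //; congr pair; exact: bool_irrelevance.
by congr pair; exact: bool_irrelevance.
Qed.

Lemma pr2_fibration : is_fibration pr2.
Proof.
split=> [[i j] j' jj'|x y z g f].
  by exists (i, j'), (lexx i, jj'); split=> //; apply/cartesian_pr2.
by rewrite !cartesian_pr2 => <- ->.
Qed.

End square_fib.

Definition square_fib (m n : Delta) : fibration :=
  Fibration (pr2_fibration 'I_m.+1 'I_n.+1).

Program Definition square_map (m n m' n' : Delta)
    (a : Hom m m') (b : Hom n n') : fibred_map (square_fib m n) (square_fib m' n') :=
  @FibredMap (square_fib m n) (square_fib m' n')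
    (prod_functor (ord_functor a) (ord_functor b)) (ord_functor b) _ _.
Next Obligation.
move=> m n m' n' a b.
exact: (@functor_eq (prod_cat (ord_cat m) (ord_cat n)) (ord_cat n')
  (fun x => ord_functor b x.2)).
Qed.
Next Obligation.
by move=> m n m' n' a b x y f /cartesian_pr2 xy; apply/cartesian_pr2; rewrite /= xy.
Qed.

Program Definition fibred_nerve (xi : fibration) : bisset :=
  @Presheaf (prod_cat Delta Delta) (fun mn => fibred_map (square_fib mn.1 mn.2) xi)
    (fun mn mn' ab s => comp_fibred s (square_map ab.1 ab.2)) _ _.
Next Obligation.
move=> xi mn s; apply: fibred_map_eq; rewrite /= !ord_functor1.
  by rewrite prod_functor1 comp_functor1.
by rewrite comp_functor1.
Qed.
Next Obligation.
move=> xi u v w b a s; apply: fibred_map_eq; rewrite /= !ord_functorM.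
  by rewrite prod_functorM comp_functorA.
by rewrite comp_functorA.
Qed.

Program Definition diag_nerve_map (xi : fibration) :
    presheaf_map (diag_sset (fibred_nerve xi)) (nerve (tot_cat xi)) :=
  @PresheafMap Delta (diag_sset (fibred_nerve xi)) (nerve (tot_cat xi))
    (fun n s => fm_total s \oF diag_functor (ord_cat n)) _.
Next Obligation. by move=> xi m n a s; exact: functor_eq. Qed.

Definition std_simplex (R : realType) (n : nat) : set 'rV[R]_n.+1 :=
  [set t | (forall i, 0 <= t ord0 i) /\ \sum_i t ord0 i = 1].

Arguments std_simplex R n : clear implicits.

Lemma simplex_push_subproof (R : realType) (m n : Delta) (a : Hom m n)
    (t : set_type (std_simplex R m)) :
  (\row_j \sum_(i | a i == j) \val t ord0 i) \in std_simplex R n.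
Proof.
case: t => t /= /set_mem[t0 t1]; apply/mem_set; split=> [j|].
  by rewrite mxE sumr_ge0.
rewrite -[RHS]t1 (partition_big a xpredT) //=.
by apply: eq_bigr => j _; rewrite mxE.
Qed.

(** The affine map extending [a] on vertices. *)
Definition simplex_push (R : realType) (m n : Delta) (a : Hom m n)
    (t : set_type (std_simplex R m)) : set_type (std_simplex R n) :=
  exist (fun u => u \in std_simplex R n) _ (simplex_push_subproof a t).

(** [R] stands for the field of real numbers, as any [realType] does. *)
Section realization.
Context (R : realType).
Local Open Scope quotient_scope.

Definition cell (X : sset) : choiceType := {classic {n : Delta & X n}}.

Definition cell_space (X : sset) (c : cell X) : topologicalType :=
  set_type (std_simplex R (projT1 c)).

(** The disjoint union of the X_n x Delta^n, X_n being discrete, as a sum of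
    simplices indexed by the simplices of X. *)
Definition cells (X : sset) : topologicalType := {c : cell X & cell_space c}.

Definition cell_point (X : sset) (n : Delta) (x : X n)
    (t : set_type (std_simplex R n)) : cells X :=
  existT (@cell_space X) (existT X n x) t.

Inductive glue_step (X : sset) : cells X -> cells X -> Prop :=
  Glue (m n : Delta) (a : Hom m n) (x : X n)
       (t : set_type (std_simplex R m)) :
    glue_step (cell_point (restr X a x) t) (cell_point x (simplex_push a t)).

Definition glued (X : sset) : rel (cells X) :=
  fun u v => `[< clos_refl_sym_trans _ (@glue_step X) u v >].

Lemma glued_refl X : reflexive (@glued X).
Proof. by move=> u; apply/asboolP; exact: rst_refl. Qed.

Lemma glued_sym X : symmetric (@glued X).
Proof. by move=> u v; apply/asboolP/asboolP => ?; exact: rst_sym. Qed.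

Lemma glued_trans X : transitive (@glued X).
Proof.
by move=> v u w /asboolP uv /asboolP vw; apply/asboolP; exact: rst_trans uv vw.
Qed.

Definition glue_equiv X :=
  EquivRel (@glued X) (@glued_refl X) (@glued_sym X) (@glued_trans X).

Definition realization (X : sset) := {eq_quot glue_equiv X}.

HB.instance Definition _ (X : sset) :=
  Topological.copy (realization X) (quotient_topology (realization X)).
HB.instance Definition _ (X : sset) := Quotient.on (realization X).

Definition cells_map (X Y : sset) (f : presheaf_map X Y) (u : cells X) :
    cells Y :=
  let: existT (existT n x) t := u in cell_point (f n x) t.

Definition realization_map (X Y : sset) (f : presheaf_map X Y)
    (z : realization X) : realization Y :=
  \pi_(realization Y) (cells_map f (repr z)).

Lemma realization_mapE (X Y : sset) (f : presheaf_map X Y) (u : cells X) :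
  realization_map f (\pi_(realization X) u) =
  \pi_(realization Y) (cells_map f u).
Proof.
rewrite /realization_map; case: piP => v /eqmodP /asboolP uv.
apply/esym/eqmodP/asboolP; elim: uv => {u v}.
- by move=> _ _ [m n a x t]; rewrite /= naturality; exact/rst_step/Glue.
- by move=> u; exact: rst_refl.
- by move=> u v _; exact: rst_sym.
- by move=> u v w _ uv _; exact: rst_trans uv.
Qed.

Definition homotopic (S T : topologicalType) (f g : S -> T) : Prop :=
  exists2 H : S * set_type `[0%R : R, 1%R]%classic -> T, continuous H &
    forall x t, (\val t = 0 -> H (x, t) = f x) /\ (\val t = 1 -> H (x, t) = g x).

Definition homotopy_equivalence (S T : topologicalType) (f : S -> T) : Prop :=
  continuous f /\
  exists g : T -> S,
    [/\ continuous g, homotopic (g \o f) id & homotopic (f \o g) id].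

Definition weak_equivalence (X Y : sset) (f : presheaf_map X Y) : Prop :=
  homotopy_equivalence (realization_map f).

End realization.

(* Main.v *)
Require Import Defs.
From HB Require Import structures.
From mathcomp Require Import all_boot all_order all_algebra generic_quotient.
From mathcomp Require Import all_classical all_reals all_analysis.
From mathcomp Require Import lra zify.
From Stdlib Require Import Relation_Operators.
Import Defs.

(** The map [k], which sends a simplex [s] of the diagonal of the fibred nerve
    to the chain s(0,0) -> ... -> s(n,n), has no simplicial inverse: to recover
    a fibred square from a chain of E, some of its arrows must be factored into
    a cartesian and a vertical part, and this can be done only after the chain
    has been cut in two.  So replace a simplicial set X by its edgewise
    subdivision Sd X, whose n-simplices are the (2n+1)-simplices of X.  A simplex
    e_0 -> ... -> e_n -> e'_0 -> ... -> e'_n of Sd (NE) yields the fibred square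
    whose value at (a, b) is the pushforward of e_a along p(e_a -> e'_b).  With a
    choice of cartesian arrows this is a simplicial map [spread], from Sd (NE) to
    the diagonal of the fibred nerve.

    The rule [z, w] |-> [z, (w/2, w/2)] is a homeomorphism from |Sd X| to |X|
    ([subdivision]); it is natural in X, and homotopic to the realization of
    the simplicial map [Sd_first] which keeps the first half of a simplex
    ([first_subdivision]).  The homotopy inverse of |k| is |spread| after the
    inverse of this homeomorphism.  By naturality it remains to relate two
    pairs of simplicial maps:
    - k o spread and [Sd_first] on Sd (NE): the arrows from e_a to the
      pushforward of e_a over p(e'_a) form a homotopy ([push_homotopy]);
    - spread o Sd k and [Sd_first] on the subdivided diagonal.  For a fibred
      square s with sides cut in two, spread o Sd k takes at (a, b) the
      pushforward of s(a,a) over the base point of b', where b' is b moved to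
      the second half.  Since s(a,a) -> s(a,b') is cartesian, this is isomorphic
      to s(a,b') ([corner_homotopy]), which receives a horizontal arrow from
      s(a,b) ([horizontal_homotopy]).

    Two facts are needed about realizations: that |Sd X| -> |X| has a continuous
    inverse, and that a simplicial homotopy realizes to a homotopy
    ([simplicial_homotopy]).  Both reduce to simplices, where they ask for a
    continuous inverse of |D| -> Z, with Z a simplex or a prism and D finite in
    each degree.  By compactness a continuous bijection is enough
    ([realization_inverse]).  Injectivity holds because a monotone map is
    determined by the image of a point with positive weights ([push_inj]) and
    because any two points of simplices have a common refinement
    ([common_refinement]). *)

Set Implicit Arguments.
Unset Strict Implicit.
Unset Printing Implicit Defensive.

Import Order.TTheory GRing.Theory Num.Theory.
Import numFieldNormedType.Exports.

Local Open Scope classical_set_scope.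
Local Open Scope ring_scope.

Local Obligation Tactic := idtac.

(** * Standard simplices *)


Definition mono_map (m n : nat) (f : 'I_m.+1 -> 'I_n.+1)
    (f_mono : forall i j : 'I_m.+1, (i <= j)%N -> (f i <= f j)%N) : @Hom Delta m n :=
  HB.pack_for {omorphism 'I_m.+1 -> 'I_n.+1} f
    (Order.isOrderMorphism.Build _ _ _ _ f f_mono).

Lemma hom_mono (m n : Delta) (a : Hom m n) (i j : 'I_m.+1) :
  (i <= j)%N -> (a i <= a j)%N.
Proof. exact: (omorph_le a). Qed.

Section simplices.
Context (R : realType).
Notation spx n := (set_type (std_simplex R n)).

Definition wt (n : nat) (t : spx n) (i : 'I_n.+1) : R := \val t ord0 i.

Lemma wt_inj n (t u : spx n) : wt t =1 wt u -> t = u.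
Proof. by move=> tu; apply/val_inj/rowP => i; exact: tu. Qed.

Lemma wt_ge0 n (t : spx n) i : 0 <= wt t i.
Proof. by case: t => t tn; have [t0 t1] := set_mem tn; exact: t0. Qed.

Lemma wt_sum n (t : spx n) : \sum_i wt t i = 1.
Proof. by case: t => t tn; have [t0 t1] := set_mem tn; exact: t1. Qed.

Lemma wt_le1 n (t : spx n) i : wt t i <= 1.
Proof.
rewrite -(wt_sum t) (bigD1 i) //= lerDl; apply: sumr_ge0 => j _; exact: wt_ge0.
Qed.

Lemma spx_subproof n (f : 'I_n.+1 -> R) :
  (forall i, 0 <= f i) -> \sum_i f i = 1 ->
  (\row_i f i) \in std_simplex R n.
Proof.
move=> f0 f1; apply/mem_set; split=> [i|]; first by rewrite mxE.
by rewrite -f1; apply: eq_bigr => i _; rewrite mxE.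
Qed.

Definition mkspx n (f : 'I_n.+1 -> R) (f0 : forall i, 0 <= f i)
    (f1 : \sum_i f i = 1) : spx n :=
  exist (fun u => u \in std_simplex R n) _ (spx_subproof f0 f1).

Lemma wt_mkspx n f f0 f1 : wt (@mkspx n f f0 f1) =1 f.
Proof. by move=> i; rewrite /wt /= mxE. Qed.

Lemma wt_push (m n : Delta) (a : Hom m n) (t : spx m) j :
  wt (simplex_push a t) j = \sum_(i | a i == j) wt t i.
Proof. by rewrite /wt /= mxE. Qed.

Lemma push_comp (m n p : Delta) (b : Hom n p) (a : Hom m n) (t : spx m) :
  simplex_push (b \oc a) t = simplex_push b (simplex_push a t).
Proof.
apply: wt_inj => k; rewrite !wt_push.
rewrite (partition_big a (fun j => b j == k)) //=.
apply: eq_bigr => j /eqP bj; rewrite wt_push; apply: eq_bigl => i.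
by case: (a i =P j) => [->|]; rewrite ?andbF // bj eqxx.
Qed.

Lemma push_id (n : Delta) (t : spx n) : simplex_push (idc n) t = t.
Proof.
by apply: wt_inj => k; rewrite !wt_push big_pred1_eq.
Qed.

Lemma wt_continuous n i : continuous (fun t : spx n => wt t i).
Proof.
move=> t; apply: (@continuous_comp _ _ _ (@set_val _ (std_simplex R n))
  (fun u : 'rV[R]_n.+1 => u ord0 i)); first exact: initial_continuous.
exact: coord_continuous.
Qed.

Lemma continuous_sumr (Z : topologicalType) (I : finType) (P : pred I)
    (f : I -> Z -> R) :
  (forall i, continuous (f i)) -> continuous (fun z => \sum_(i | P i) f i z).
Proof.
move=> cf z; apply: cvg_big => [|i _]; last exact: cf.
exact: add_continuous.
Qed.

Lemma spx_continuous (Z : topologicalType) n (f : Z -> spx n) :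
  (forall i, continuous (fun z => wt (f z) i)) -> continuous f.
Proof.
move=> cf; apply: continuous_comp_initial => z U [P Pn PU].
suff: \forall z' \near z, forall i j, P i j (\val (f z') i j).
  by apply: filterS => z' Pz'; exact: PU.
apply: filter_forall => i; apply: filter_forall => j.
by have := Pn i j; rewrite (ord1 i) => /(cf j z); exact.
Qed.

Lemma set_type_compact (X : topologicalType) (A : set X) :
  compact A -> compact [set: set_type A].
Proof.
move=> cA F FF _; have [|p [Ap clp]] := cA (fmap (@set_val _ A) F) _.
  apply: (@filterS _ F _ setT); last exact: filterT.
  by move=> [x xA] _; exact: set_mem xA.
exists (exist (fun u => u \in A) p (mem_set Ap)); split=> // B C FB.
rewrite nbhsE => -[_ [[W oW <-] Wp] WC].
have [] := clp (set_val @` B) W.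
- by apply: (@filterS _ F _ B) => // b Bb; exists b.
- exact: open_nbhs_nbhs.
by move=> _ [[b Bb <-] Wb]; exists b; split=> //; exact: WC.
Qed.

Lemma spx_compact n : compact [set: spx n].
Proof.
apply: set_type_compact.
have cube : compact [set v : 'rV[R]_n.+1 | forall i, `[0, 1]%classic (v ord0 i)].
  exact: (@rV_compact R n.+1 (fun=> `[0, 1]%classic) (fun=> @segment_compact R 0 1)).
apply: (subclosed_compact _ cube).
- rewrite (_ : std_simplex R n =
    \bigcap_(i in [set: 'I_n.+1]) [set t : 'rV[R]_n.+1 | 0 <= t ord0 i]
    `&` [set t : 'rV[R]_n.+1 | \sum_i t ord0 i = 1]); last first.
    by apply/seteqP; split=> t [t0 t1]; split=> // i; [move=> _|]; exact: t0.
  apply: closedI.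
    apply: closed_bigI => i _.
    apply: (@preimage_closed _ _ (fun t : 'rV[R]_n.+1 => t ord0 i)
      [set x | 0 <= x]); last exact: closed_ge.
    by move=> t _; exact: coord_continuous.
  apply: (@preimage_closed _ _ (fun t : 'rV[R]_n.+1 => \sum_i t ord0 i)
    [set x | x = 1]); last exact: closed_eq.
  by move=> t _; apply: continuous_sumr => i; exact: coord_continuous.
- move=> t tn i; rewrite /= in_itv /=.
  have := wt_ge0 (exist (fun u => u \in std_simplex R n) t (mem_set tn)) i.
  have := wt_le1 (exist (fun u => u \in std_simplex R n) t (mem_set tn)) i.
  by rewrite /wt /= => -> ->.
Qed.

Lemma separated_hausdorff (Z : topologicalType) (I : Type) (f : I -> Z -> R) :
  (forall i, continuous (f i)) -> (forall x y, (forall i, f i x = f i y) -> x = y) ->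
  hausdorff_space Z.
Proof.
move=> cf sep x y xy; apply: sep => i; apply: (@Rhausdorff R) => A B nA nB.
by have [z [Az Bz]] := xy _ _ (cf i x _ nA) (cf i y _ nB); exists (f i z).
Qed.

Lemma push_continuous (m n : Delta) (a : Hom m n) :
  continuous (@simplex_push R m n a).
Proof.
apply: spx_continuous => j.
rewrite (_ : (fun z => _) = fun z => \sum_(i | a i == j) wt z i); last first.
  by apply/funext => z; rewrite wt_push.
by apply: continuous_sumr => i; exact: wt_continuous.
Qed.

(** The preimage of a closed set is a finite union of images of compact sets,
    so the maps [phi j] together behave like a quotient map. *)
Lemma compact_cover_continuous (Z T : topologicalType) (J : choiceType)
    (A : set J) (K : J -> topologicalType) (phi : forall j, K j -> Z) (f : Z -> T) :
  hausdorff_space Z -> finite_set A ->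
  (forall j, compact [set: K j]) -> (forall j, continuous (phi j)) ->
  (forall j, continuous (f \o phi j)) ->
  (forall z, exists2 j, A j & exists k, phi j k = z) ->
  continuous f.
Proof.
move=> hZ fA cK cphi cf surj; apply/continuous_closedP => C cC.
rewrite (_ : f @^-1` C = \bigcup_(j in A) (phi j @` ((f \o phi j) @^-1` C))).
  apply: closed_bigcup => // j Aj; apply: compact_closed => //.
  apply: continuous_compact; first exact: continuous_subspaceT.
  apply: (@subclosed_compact _ _ setT) => //; first by move/continuous_closedP: (cf j); exact.
apply/seteqP; split=> [z Cz|z [j _ [k Ck <-]]] //.
by have [j Aj [k kz]] := surj z; exists j => //; exists k; rewrite /= ?kz.
Qed.

End simplices.

(** * Continuous maps out of a realization *)
Section real.
Context (R : realType).
Notation spx n := (set_type (std_simplex R n)).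
Notation unit_itv := (set_type `[0%R : R, 1%R]%classic).
Notation real X := (realization R X).

Definition rpoint (X : sset) (n : Delta) (x : X n) (t : spx n) : real X :=
  \pi_(realization R X)%qT (cell_point x t).

Lemma rpoint_glue (X : sset) (m n : Delta) (a : Hom m n) (x : X n) (t : spx m) :
  rpoint (restr X a x) t = rpoint x (simplex_push a t).
Proof. by apply/eqmodP/asboolP/rst_step; exact: Glue. Qed.

Lemma rpoint_map (X Y : sset) (f : presheaf_map X Y) n (x : X n) (t : spx n) :
  realization_map f (rpoint x t) = rpoint (f n x) t.
Proof. exact: realization_mapE. Qed.

Lemma rpointP (X : sset) (z : real X) :
  exists n (x : X n) (t : spx n), z = rpoint x t.
Proof.
elim/quotW: z => -[[n x] t]; by exists n, x, t.
Qed.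

Lemma rpoint_continuous (X : sset) n (x : X n) : continuous (@rpoint X n x).
Proof.
move=> t; apply: (@continuous_comp _ _ _ (@cell_point R X n x)).
  exact: existT_continuous.
exact: pi_continuous.
Qed.

Lemma realization_continuous (X : sset) (T : topologicalType) (f : real X -> T) :
  (forall n (x : X n), continuous (f \o rpoint x)) -> continuous f.
Proof.
move=> cf; apply/quotient_continuous.
rewrite (_ : f \o _ = unstable.sigT_fun (fun c : cell X => fun t : cell_space R c =>
  f (rpoint (projT2 c) t))); last by apply/funext => -[[n x] t].
by apply: sigT_continuous => -[n x]; exact: cf.
Qed.

Lemma realization_lift (X : sset) (T : Type)
    (F : forall n : Delta, X n -> spx n -> T) :
  (forall (m n : Delta) (a : Hom m n) x t,
     F m (restr X a x) t = F n x (simplex_push a t)) ->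
  exists f : real X -> T, forall n x t, f (rpoint x t) = F n x t.
Proof.
move=> FE; pose G (u : cells R X) : T := let: existT (existT n x) t := u in F n x t.
exists (fun z => G (repr z)) => n x t.
rewrite /rpoint -[RHS]/(G (cell_point x t)).
case: piP => v /eqmodP/asboolP uv.
elim: uv => {v n x t} [_ _ [m n a x t]|//|u v _ ->//|u v w _ -> _ ->//].
by rewrite /= FE.
Qed.

Lemma unit_itv_compact : compact [set: unit_itv].
Proof. by apply: set_type_compact; exact: segment_compact. Qed.

Lemma unit_itv_hausdorff : hausdorff_space unit_itv.
Proof.
apply: (@separated_hausdorff R unit_itv unit
  (fun _ (s : unit_itv) => \val s : R)) => [_|s t st].
  exact: initial_continuous.
by apply/val_inj/(st tt).
Qed.

(** Multiplication by the unit interval preserves quotient maps, because the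
    interval is locally compact: pass to the curried map, with values in the
    paths of [T] under the compact-open topology. *)
Lemma realization_prod_continuous (X : sset) (T : topologicalType)
    (f : real X * unit_itv -> T) :
  (forall n (x : X n), continuous (fun ts : spx n * unit_itv => f (rpoint x ts.1, ts.2))) ->
  continuous f.
Proof.
move=> cf; have lcI : locally_compact [set: unit_itv].
  move=> s _; exists setT; rewrite ?withinET; first exact: filterT.
  by split; [exact: unit_itv_compact | exact: closedT].
have -> : f = uncurry (curry f) by apply/funext => -[].
apply: (@continuous_uncurry (real X) unit_itv T) => //.
- exact: unit_itv_hausdorff.
- apply: (@realization_continuous X {compact-open, unit_itv -> T} (curry f)) => n x.
  exact: (@continuous_curry_fun _ _ _ _ (cf n x)).
- move=> z; have [n [x [t ->]]] := rpointP z.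
  have [_ /(_ t)] := continuous_curry (cf n x); exact.
Qed.

Lemma realization_map_continuous (X Y : sset) (f : presheaf_map X Y) :
  continuous (realization_map f : real X -> real Y).
Proof.
apply: realization_continuous => n x.
rewrite (_ : _ \o _ = rpoint (f n x)); first exact: rpoint_continuous.
by apply/funext => t; exact: rpoint_map.
Qed.

(** ** Homotopies *)
Lemma continuous_pair (Z U V : topologicalType) (f : Z -> U) (g : Z -> V) :
  continuous f -> continuous g -> continuous (fun z => (f z, g z)).
Proof.
by move=> cf cg z; exact: cvg_pair (cf z) (cg z).
Qed.

Lemma clamp_subproof (x : R) : Num.max 0 (Num.min 1 x) \in `[0%R : R, 1%R]%classic.
Proof.
apply/mem_set; rewrite /= in_itv /=.
by rewrite le_max lexx ge_max ler01 ge_min lexx.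
Qed.

(** The retraction of the line onto the unit interval; reparametrizations of
    homotopies are written with it to keep them total. *)
Definition clamp (x : R) : unit_itv :=
  exist (fun u => u \in `[0%R : R, 1%R]%classic) _ (clamp_subproof x).

Lemma clamp_continuous : continuous clamp.
Proof.
apply: continuous_comp_initial => x /=.
apply: (@continuous_max _ R (fun=> 0) (fun x => Num.min 1 x)).
  exact: cvg_cst.
by apply: (@continuous_min _ R (fun=> 1) id); [exact: cvg_cst|exact: cvg_id].
Qed.

Lemma clampE x : 0 <= x <= 1 -> \val (clamp x) = x.
Proof. by move=> /andP[x0 x1] /=; rewrite min_r // max_r. Qed.

Lemma unit_itvP (s : unit_itv) : 0 <= \val s <= 1.
Proof. by case: s => s /= /set_mem; rewrite /= in_itv. Qed.

Lemma val_continuous : continuous (fun s : unit_itv => \val s : R).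
Proof. exact: initial_continuous. Qed.

Lemma clamp_comp_continuous (Z : topologicalType) (f : Z -> R) :
  continuous f -> continuous (clamp \o f).
Proof.
by move=> cf z; apply: continuous_comp; [exact: cf|exact: clamp_continuous].
Qed.

Section homotopic.
Context (S T : topologicalType).

Lemma reparam_continuous (H : S * unit_itv -> T) (u : R -> R) :
  continuous H -> continuous u ->
  continuous (fun xt : S * unit_itv => H (xt.1, clamp (u (\val xt.2)))).
Proof.
move=> cH cu xt.
apply: (@continuous_comp _ _ _
  (fun xt : S * unit_itv => (xt.1, clamp (u (\val xt.2))))); last exact: cH.
apply: continuous_pair => z; first exact: cvg_fst.
apply: (@clamp_comp_continuous _ (fun xt : S * unit_itv => u (\val xt.2))) => {}z.
apply: (@continuous_comp _ _ _ (fun xt : S * unit_itv => \val xt.2)); last exact: cu.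
apply: (@continuous_comp _ _ _ snd); first exact: cvg_snd.
exact: val_continuous.
Qed.

Lemma homotopic_sym (f g : S -> T) : homotopic R f g -> homotopic R g f.
Proof.
move=> [H cH HE].
exists (fun xt => H (xt.1, clamp (1 - \val xt.2))).
  apply: (@reparam_continuous H (fun s => 1 - s)) => // s.
  by apply: cvgB; [exact: cvg_cst|exact: cvg_id].
move=> x t; have [H0 H1] := HE x (clamp (1 - \val t)).
by split=> t01; [apply: H1|apply: H0]; rewrite t01 clampE; lra.
Qed.

Lemma homotopic_trans (f g h : S -> T) :
  homotopic R f g -> homotopic R g h -> homotopic R f h.
Proof.
move=> [H cH HE] [K cK KE].
pose H' (xt : S * unit_itv) := H (xt.1, clamp (2 * \val xt.2)).
pose K' (xt : S * unit_itv) := K (xt.1, clamp (2 * \val xt.2 - 1)).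
pose L xt := if \val xt.2 <= 2^-1 then H' xt else K' xt.
(* the two halves agree where they meet *)
have LK xt : 2^-1 <= \val xt.2 -> L xt = K' xt.
  rewrite /L /H' /K'; case: ifP => // a b; have -> : \val xt.2 = 2^-1 by lra.
  have [_ ->] := HE xt.1 (clamp (2 * 2^-1)); last by rewrite clampE; lra.
  by have [->] := KE xt.1 (clamp (2 * 2^-1 - 1)); last by rewrite clampE; lra.
have c2 : continuous (fun xt : S * unit_itv => \val xt.2 : R).
  move=> xt; apply: (@continuous_comp _ _ _ snd); first exact: cvg_snd.
  exact: val_continuous.
exists L => [|x t].
  apply/continuous_closedP => C cC.
  rewrite (_ : L @^-1` C = ((fun xt => \val xt.2) @^-1` [set x | x <= 2^-1] `&` H' @^-1` C)
     `|` ((fun xt => \val xt.2) @^-1` [set x | 2^-1 <= x] `&` K' @^-1` C)).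
    apply: closedU; apply: closedI.
    - by move/continuous_closedP: c2; apply; exact: closed_le.
    - have : continuous H'.
        apply: (@reparam_continuous H (fun s => 2 * s)) => // s.
        by apply: cvgM; [exact: cvg_cst|exact: cvg_id].
      by move/continuous_closedP; exact.
    - by move/continuous_closedP: c2; apply; exact: closed_ge.
    - have : continuous K'.
        apply: (@reparam_continuous K (fun s => 2 * s - 1)) => // s.
        apply: cvgB; last exact: cvg_cst.
        by apply: cvgM; [exact: cvg_cst|exact: cvg_id].
      by move/continuous_closedP; exact.
  apply/seteqP; split=> [xt /= Cx|xt /=].
    have [t2|t2] := leP (\val xt.2) (2^-1); [left|right].
      by split=> //; move: Cx; rewrite /L t2.
    by split=> //; [exact: ltW|rewrite -LK // ltW].
  by move=> [[t2 Cx]|[t2 Cx]]; [rewrite /L t2|rewrite LK].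
split=> t01.
  rewrite /L /H' /= ifT t01; last by lra.
  by have [->] := HE x (clamp (2 * 0)); last by rewrite clampE; lra.
rewrite LK /K' /= t01; last by lra.
by have [_ ->] := KE x (clamp (2 * 1 - 1)); last by rewrite clampE; lra.
Qed.

Lemma homotopic_precomp (S' : topologicalType) (k : S' -> S) (f g : S -> T) :
  continuous k -> homotopic R f g -> homotopic R (f \o k) (g \o k).
Proof.
move=> ck [H cH HE]; exists (fun xt => H (k xt.1, xt.2)) => [|x t]; last exact: HE.
move=> xt; apply: (@continuous_comp _ _ _
  (fun xt : S' * unit_itv => (k xt.1, xt.2))); last exact: cH.
apply: continuous_pair => [z|z]; last exact: cvg_snd.
by apply: (@continuous_comp _ _ _ fst k); [exact: cvg_fst|exact: ck].
Qed.

End homotopic.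
End real.

(** * Refinements of points of simplices *)
Section refine.
Context (R : realType).
Notation spx n := (set_type (std_simplex R n)).
Notation unit_itv := (set_type `[0%R : R, 1%R]%classic).

Lemma cumul_push (m n : Delta) (a : Hom m n) (t : spx m) (k : nat) :
  \sum_(j : 'I_n.+1 | (j <= k)%N) wt (simplex_push a t) j =
  \sum_(i : 'I_m.+1 | (a i <= k)%N) wt t i.
Proof.
rewrite (partition_big a (fun j => (j <= k)%N)) //=.
apply: eq_bigr => j jk; rewrite wt_push; apply: eq_bigl => i.
by case: (a i =P j) => [->|]; rewrite ?andbF // jk.
Qed.

(** If a i < b i, then b i' <= a i implies i' < i, hence a i' <= a i; so the mass
    sent by a below a i exceeds that sent by b by at least the weight of i. *)
Lemma push_inj_le (r n : Delta) (a b : Hom r n) (w : spx r) :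
  (forall i, 0 < wt w i) -> simplex_push a w = simplex_push b w ->
  forall i, (b i <= a i)%N.
Proof.
move=> w0 ab i; rewrite leqNgt; apply/negP => aib.
have := cumul_push a w (a i); rewrite ab cumul_push.
rewrite [RHS](bigID (fun i' => (b i' <= a i)%N)) /=.
rewrite [X in _ = X + _](eq_bigl (fun i' => (b i' <= a i)%N)); last first.
  move=> i'; apply/andP/idP => [[]//|bi']; split=> //; apply: hom_mono.
  rewrite leqNgt; apply/negP => /ltnW /(hom_mono b) bii'.
  by have := leq_ltn_trans (leq_trans bii' bi') aib; rewrite ltnn.
move/eqP; rewrite -[X in X == _]addr0 (inj_eq (addrI _)) => /eqP.
rewrite (bigD1 i) /=; last by rewrite leqnn -ltnNge.
have : 0 <= \sum_(j < r.+1 | ((a j <= a i)%N && ~~ (b j <= a i)%N) && (j != i)) wt w j.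
  by apply: sumr_ge0 => j _; exact: wt_ge0.
by have := w0 i; lra.
Qed.

Lemma push_inj (r n : Delta) (a b : Hom r n) (w : spx r) :
  (forall i, 0 < wt w i) -> simplex_push a w = simplex_push b w -> a = b.
Proof.
move=> w0 ab; apply: omorphism_eq => i; apply/val_inj/eqP.
by rewrite eqn_leq (push_inj_le w0 ab) (push_inj_le w0 (esym ab)).
Qed.

(** The north-west corner rule: match as much mass as possible between the
    least points of the two supports, remove it, and start again.  At least one
    of these two points leaves its support, so there are at most [N] steps, and
    the labels never decrease. *)
Lemma greedy_coupling (p q : nat) (N : nat) (u : 'I_p -> R) (v : 'I_q -> R) :
  (forall i, 0 <= u i) -> (forall j, 0 <= v j) -> \sum_i u i = \sum_j v j ->
  (#|[pred i | (0 < u i)%R]| + #|[pred j | (0 < v j)%R]| <= N)%N ->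
  exists L : seq (R * ('I_p * 'I_q)),
    [/\ (size L <= N)%N,
        pairwise (fun x y : R * ('I_p * 'I_q) =>
          (x.2.1 <= y.2.1)%N && (x.2.2 <= y.2.2)%N) L,
        all (fun x => [&& 0 < x.1, 0 < u x.2.1 & 0 < v x.2.2]) L,
        forall i, \sum_(x <- L | x.2.1 == i) x.1 = u i &
        forall j, \sum_(x <- L | x.2.2 == j) x.1 = v j].
Proof.
elim: N u v => [|N IH] u v u0 v0 uv cN.
  have uz i : u i = 0.
    apply/eqP; have := u0 i; rewrite le_eqVlt eq_sym => /orP[//|ui].
    by move: cN; rewrite leqn0 addn_eq0 => /andP[/eqP/card0_eq/(_ i)]; rewrite inE ui.
  have vz j : v j = 0.
    apply/eqP; have := v0 j; rewrite le_eqVlt eq_sym => /orP[//|vj].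
    by move: cN; rewrite leqn0 addn_eq0 => /andP[_ /eqP/card0_eq/(_ j)]; rewrite inE vj.
  by exists [::]; split=> // i; rewrite big_nil ?uz ?vz.
have [[i1 ui1]|nu] := pselect (exists i, 0 < u i); last first.
  have uz i : u i = 0.
    apply/eqP; have := u0 i; rewrite le_eqVlt eq_sym => /orP[//|ui].
    by case: nu; exists i.
  have sv : \sum_j v j = 0 by rewrite -uv big1.
  have vz j : v j = 0 by have := psumr_eq0P (fun j _ => v0 j) sv; exact.
  by exists [::]; split=> // i; rewrite big_nil ?uz ?vz.
have [j1 vj1] : exists j, 0 < v j.
  apply: contrapT => nv; have sv : \sum_i u i = 0.
    rewrite uv big1 // => j _; apply/eqP; have := v0 j.
    by rewrite le_eqVlt eq_sym => /orP[//|vj]; case: nv; exists j.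
  have uz := psumr_eq0P (fun j _ => u0 j) sv.
  by move: ui1; rewrite uz ?ltxx.
(* the least points of the supports, and the mass m moved between them *)
case: (arg_minnP (P := fun i => 0 < u i) (fun i : 'I_p => val i) ui1) => i0 ui0 mini.
case: (arg_minnP (P := fun j => 0 < v j) (fun j : 'I_q => val j) vj1) => j0 vj0 minj.
pose m := Num.min (u i0) (v j0).
have m0 : 0 < m by rewrite lt_min ui0.
have mu : m <= u i0 by rewrite ge_min lexx.
have mv : m <= v j0 by rewrite ge_min lexx orbT.
pose u' i := u i - (if i == i0 then m else 0).
pose v' j := v j - (if j == j0 then m else 0).
have u'0 i : 0 <= u' i by rewrite /u'; case: eqP => [->|_]; rewrite ?subr0 ?subr_ge0.
have v'0 j : 0 <= v' j by rewrite /v'; case: eqP => [->|_]; rewrite ?subr0 ?subr_ge0.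
have u'u i : u' i <= u i by rewrite /u'; case: ifP => _; rewrite ?subr0 // gerBl ltW.
have v'v j : v' j <= v j by rewrite /v'; case: ifP => _; rewrite ?subr0 // gerBl ltW.
have u'v' : \sum_i u' i = \sum_j v' j.
  by rewrite !sumrB uv -!big_mkcond /= !big_pred1_eq.
have su : [pred i | (0 < u' i)%R] \subset [pred i | 0 < u i].
  by apply/fintype.subsetP => i; rewrite !inE => /lt_le_trans; exact.
have sv : [pred j | 0 < v' j] \subset [pred j | 0 < v j].
  by apply/fintype.subsetP => j; rewrite !inE => /lt_le_trans; exact.
have cN' : (#|[pred i | (0 < u' i)%R]| + #|[pred j | (0 < v' j)%R]| <= N)%N.
  rewrite -ltnS; apply: leq_trans cN.
  have [uv0|vu0] := leP (u i0) (v j0).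
    rewrite -addSn leq_add ?subset_leq_card //; apply: proper_card.
    apply/fintype.properP; split=> //; exists i0; rewrite !inE //.
    by rewrite /u' eqxx /m min_l // subrr ltxx.
  rewrite -addnS leq_add ?subset_leq_card //; apply: proper_card.
  apply/fintype.properP; split=> //; exists j0; rewrite !inE //.
  by rewrite /v' eqxx /m min_r ?ltW // subrr ltxx.
have [L [sL pL aL Lu Lv]] := IH u' v' u'0 v'0 u'v' cN'.
exists ((m, (i0, j0)) :: L); split=> //=.
- rewrite pL andbT; apply/allP => x /(allP aL) /and3P[_ ux vx].
  have uxx := lt_le_trans ux (u'u _); have vxx := lt_le_trans vx (v'v _).
  by rewrite mini ?minj.
- rewrite m0 ui0 vj0 /=; apply/allP => x /(allP aL) /and3P[-> ux vx].
  by rewrite (lt_le_trans ux) // (lt_le_trans vx).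
- move=> i; rewrite big_cons /= Lu /u' eq_sym.
  by case: eqP => [->|_]; [rewrite addrC subrK|rewrite subr0].
- move=> j; rewrite big_cons /= Lv /v' eq_sym.
  by case: eqP => [->|_]; [rewrite addrC subrK|rewrite subr0].
Qed.

(** The weights of the coupling of [u] and [v] form a point [w] that refines both;
    a uniform bound on [r] is kept for the compactness argument of
    [realization_inverse]. *)
Lemma common_refinement (p q : nat) (u : spx p) (v : spx q) :
  exists (r : nat) (w : spx r) (a : @Hom Delta r p) (b : @Hom Delta r q),
    [/\ (r <= p + q + 1)%N, forall i, 0 < wt w i,
        simplex_push a w = u & simplex_push b w = v].
Proof.
have [|L [sL pL aL Lu Lv]] := @greedy_coupling p.+1 q.+1 (p + q + 2) (wt u) (wt v)
  (wt_ge0 u) (wt_ge0 v) (etrans (wt_sum u) (esym (wt_sum v))).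
  by apply: leq_trans (leq_add (max_card _) (max_card _)) _; rewrite !card_ord; lia.
have s1 : \sum_(x <- L) x.1 = 1.
  rewrite -(wt_sum u) (partition_big (fun x => x.2.1) xpredT) //=.
  by apply: eq_bigr => i _; rewrite Lu.
case: L => [|x0 L'] in sL pL aL Lu Lv s1 *.
  by move: s1; rewrite big_nil => /eqP; rewrite eq_sym oner_eq0.
set L := x0 :: L' in sL pL aL Lu Lv s1 *.
pose r := size L'.
have sumE (P : pred _) : \sum_(x <- L | P x) x.1 =
    \sum_(i < r.+1 | P (nth x0 L i)) (nth x0 L i).1.
  by rewrite (big_nth x0) big_mkord.
have w0 i : (i < r.+1)%N -> 0 < (nth x0 L i).1.
  by move=> ir; have /and3P[] := allP aL _ (@mem_nth _ x0 L i ir).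
have w1 : \sum_(i < r.+1) (nth x0 L i).1 = 1 by rewrite -[RHS]s1 [RHS]sumE.
have Lmono (i j : 'I_r.+1) : (i <= j)%N ->
    ((nth x0 L i).2.1 <= (nth x0 L j).2.1)%N /\ ((nth x0 L i).2.2 <= (nth x0 L j).2.2)%N.
  rewrite leq_eqVlt => /orP[/eqP ->|ij] //.
  by have /andP[] := pairwiseP x0 pL i j (ltn_ord i) (ltn_ord j) ij.
pose w : spx r := mkspx (fun i : 'I_r.+1 => ltW (w0 i (ltn_ord i))) w1.
pose a : @Hom Delta r p := mono_map (fun i j ij => (Lmono i j ij).1).
pose b : @Hom Delta r q := mono_map (fun i j ij => (Lmono i j ij).2).
exists r, w, a, b; split.
- by move: sL; rewrite /= -/r; lia.
- by move=> i; rewrite wt_mkspx; exact: (w0 i (ltn_ord i)).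
- apply: wt_inj => j; rewrite wt_push -Lu sumE.
  by apply: eq_bigr => i _; rewrite wt_mkspx.
- apply: wt_inj => j; rewrite wt_push -Lv sumE.
  by apply: eq_bigr => i _; rewrite wt_mkspx.
Qed.

(** * The edgewise subdivision *)
Definition join_fun (m n : nat) (T : Type) (f : 'I_m -> T) (g : 'I_n -> T)
    (i : 'I_(m + n)) : T :=
  match fintype.split i with inl j => f j | inr j => g j end.

Lemma join_funl m n T f g j : @join_fun m n T f g (lshift n j) = f j.
Proof. by rewrite /join_fun (unsplitK (inl j)). Qed.

Lemma join_funr m n T f g j : @join_fun m n T f g (rshift m j) = g j.
Proof. by rewrite /join_fun (unsplitK (inr j)). Qed.

Lemma join_sum m n (V : nmodType) (f : 'I_m -> V) (g : 'I_n -> V)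
    (P : pred 'I_m) (Q : pred 'I_n) :
  \sum_(i | join_fun P Q i) join_fun f g i = \sum_(i | P i) f i + \sum_(j | Q j) g j.
Proof.
rewrite big_split_ord /=; congr (_ + _); apply: eq_big => i;
  by rewrite ?join_funl ?join_funr.
Qed.

(** The ordinal [dbl n] is the join of two copies of [n]; with this form of the
    sum, ['I_(dbl n).+1] is convertible to ['I_(n.+1 + n.+1)]. *)
Definition dbl (n : nat) : nat := (n + n.+1)%N.

Lemma join_mono (r m n : nat) (a : @Hom Delta r n) (b : @Hom Delta m n) :
  (forall i j, (a i <= b j)%N) ->
  forall i j : 'I_(r.+1 + m.+1), (i <= j)%N ->
  (join_fun a b i <= join_fun a b j)%N.
Proof.
move=> ab i j; rewrite /join_fun; case: splitP => i' ->; case: splitP => j' -> //.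
- exact: hom_mono.
- by move=> ij; have := leq_ltn_trans ij (ltn_ord j'); rewrite ltnNge leq_addr.
- by rewrite leq_add2l; exact: hom_mono.
Qed.

Definition hom_join (r n : nat) (a b : @Hom Delta r n)
    (ab : forall i j, (a i <= b j)%N) : @Hom Delta (dbl r) n :=
  mono_map (join_mono ab).

Lemma lshift_mono (n : nat) (i j : 'I_n.+1) :
  (i <= j)%N -> (lshift n.+1 i <= lshift n.+1 j)%N.
Proof. by []. Qed.

Lemma rshift_mono (n : nat) (i j : 'I_n.+1) :
  (i <= j)%N -> (rshift n.+1 i <= rshift n.+1 j)%N.
Proof. by rewrite /= leq_add2l. Qed.

Definition join_left (n : nat) : @Hom Delta n (dbl n) := mono_map (@lshift_mono n).
Definition join_right (n : nat) : @Hom Delta n (dbl n) := mono_map (@rshift_mono n).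

Lemma join_left_right n i j : (join_left n i <= join_right n j)%N.
Proof. by rewrite /= (leq_trans (ltnW (ltn_ord i))) // leq_addr. Qed.

Lemma dbl_hom_eq (n m : nat) (a b : @Hom Delta (dbl n) m) :
  (forall i, a (join_left n i) = b (join_left n i)) ->
  (forall i, a (join_right n i) = b (join_right n i)) ->
  a = b.
Proof.
move=> abl abr; apply: omorphism_eq => i.
case: (@splitP n.+1 n.+1 i) => j ij.
  by rewrite (_ : i = join_left n j) ?abl //; exact: val_inj.
by rewrite (_ : i = join_right n j) ?abr //; exact: val_inj.
Qed.

Lemma hom_joinl (r n : nat) (a b : @Hom Delta r n) ab i :
  @hom_join r n a b ab (join_left r i) = a i.
Proof. exact: join_funl. Qed.

Lemma hom_joinr (r n : nat) (a b : @Hom Delta r n) ab i :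
  @hom_join r n a b ab (join_right r i) = b i.
Proof. exact: join_funr. Qed.

Lemma dbl_map_subproof (m n : nat) (a : @Hom Delta m n) i j :
  ((join_left n \oc a : @Hom Delta m (dbl n)) i <=
   (join_right n \oc a : @Hom Delta m (dbl n)) j)%N.
Proof. exact: join_left_right. Qed.

Definition dbl_map (m n : nat) (a : @Hom Delta m n) : @Hom Delta (dbl m) (dbl n) :=
  hom_join (dbl_map_subproof a).

Program Definition dbl_functor : functor Delta Delta :=
  @Functor Delta Delta dbl dbl_map _ _.
Next Obligation.
by move=> n; apply: dbl_hom_eq => i; rewrite /dbl_map ?hom_joinl ?hom_joinr.
Qed.
Next Obligation.
move=> m n p b a; apply: dbl_hom_eq => i; rewrite /dbl_map /= ?hom_joinl ?hom_joinr.
  by rewrite /= !join_funl.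
by rewrite /= !join_funr.
Qed.

Definition Sd (X : sset) : sset := pull_presheaf dbl_functor X.

Lemma mix_subproof0 (n : nat) (s : unit_itv) (w : spx n) (i : 'I_(n.+1 + n.+1)) :
  0 <= join_fun (fun i => (1 - \val s) * wt w i) (fun i => \val s * wt w i) i.
Proof.
have /andP[s0 s1] := unit_itvP s.
rewrite /join_fun; case: fintype.split => j; apply: mulr_ge0 => //;
  by rewrite ?wt_ge0 ?subr_ge0.
Qed.

Lemma mix_subproof1 (n : nat) (s : unit_itv) (w : spx n) :
  \sum_(i < n.+1 + n.+1)
    join_fun (fun i => (1 - \val s) * wt w i) (fun i => \val s * wt w i) i = 1.
Proof.
have := join_sum (fun i : 'I_n.+1 => (1 - \val s) * wt w i)
  (fun i => \val s * wt w i) xpredT xpredT.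
rewrite -!mulr_sumr !wt_sum !mulr1 subrK => E; rewrite -[RHS]E.
by apply: eq_bigl => i; rewrite /join_fun; case: fintype.split.
Qed.

(** The point ((1 - s) w, s w) of the join of two copies of a simplex. *)
Definition mix (n : nat) (s : unit_itv) (w : spx n) : spx (dbl n) :=
  mkspx (mix_subproof0 s w) (mix_subproof1 s w).

Lemma wt_mixl n s w i : wt (@mix n s w) (join_left n i) = (1 - \val s) * wt w i.
Proof. by rewrite wt_mkspx; exact: join_funl. Qed.

Lemma wt_mixr n s w i : wt (@mix n s w) (join_right n i) = \val s * wt w i.
Proof. by rewrite wt_mkspx; exact: join_funr. Qed.

Lemma wt_push_mix (n m : nat) (c : @Hom Delta (dbl n) m) s (w : spx n) k :
  wt (simplex_push c (mix s w)) k =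
  (1 - \val s) * wt (simplex_push (c \oc join_left n : @Hom Delta n m) w) k +
  \val s * wt (simplex_push (c \oc join_right n : @Hom Delta n m) w) k.
Proof.
rewrite !wt_push !mulr_sumr.
rewrite (@big_split_ord _ _ _ n.+1 n.+1 (fun i => c i == k)) /=.
congr (_ + _); apply: eq_bigr => i _; [exact: wt_mixl|exact: wt_mixr].
Qed.

(** The mixture is natural in the simplex, which is what makes
    (z, w) |-> [z, mix s w] compatible with gluing. *)
Lemma mix_push (m n : nat) (a : @Hom Delta m n) s (w : spx m) :
  simplex_push (dbl_map a) (mix s w) = mix s (simplex_push a w).
Proof.
apply: wt_inj => k; rewrite wt_push_mix.
rewrite (_ : dbl_map a \oc join_left m = join_left n \oc a); last first.
  by apply: omorphism_eq => i; exact: join_funl.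
rewrite (_ : dbl_map a \oc join_right m = join_right n \oc a); last first.
  by apply: omorphism_eq => i; exact: join_funr.
rewrite !wt_push.
case: (@splitP n.+1 n.+1 k) => j kj.
  have -> : k = join_left n j by apply: val_inj.
  rewrite wt_mixl wt_push [X in _ + _ * X]big1 ?mulr0 ?addr0; last first.
    by move=> i /eqP/(congr1 val) /=; have := ltn_ord j; lia.
  by congr (_ * _); apply: eq_bigl => i; rewrite -!val_eqE.
have -> : k = join_right n j by apply: val_inj.
rewrite wt_mixr wt_push [X in _ * X + _]big1 ?mulr0 ?add0r; last first.
  by move=> i /eqP/(congr1 val) /=; have := ltn_ord (a i); lia.
by congr (_ * _); apply: eq_bigl => i; rewrite -!val_eqE /= eqn_add2l.
Qed.

Lemma mix0 n (s : unit_itv) (w : spx n) : \val s = 0 -> mix s w = simplex_push (join_left n) w.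
Proof.
move=> s0; rewrite -[LHS](@push_id R (dbl n)).
apply: wt_inj => k; rewrite wt_push_mix s0 subr0 mul1r mul0r addr0.
by congr (wt (simplex_push _ _) _); apply: omorphism_eq.
Qed.

Lemma mix_continuous n : continuous (fun sw : unit_itv * spx n => mix sw.1 sw.2).
Proof.
apply: spx_continuous => k.
have c1 : continuous (fun sw : unit_itv * spx n => \val sw.1 : R).
  move=> z; apply: (@continuous_comp _ _ _ fst (fun s : unit_itv => \val s : R)).
    exact: cvg_fst.
  exact: val_continuous.
have c2 i : continuous (fun sw : unit_itv * spx n => wt sw.2 i).
  move=> z; apply: (@continuous_comp _ _ _ snd (fun w : spx n => wt w i)).
    exact: cvg_snd.
  exact: wt_continuous.
case: (@splitP n.+1 n.+1 k) => j kj.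
  rewrite (_ : k = join_left n j); last exact: val_inj.
  rewrite (_ : (fun z => _) =
    fun sw : unit_itv * spx n => (1 - \val sw.1) * wt sw.2 j); last first.
    by apply/funext => z; rewrite wt_mixl.
  move=> z; apply: cvgM; last exact: c2.
  by apply: cvgB; [exact: cvg_cst|exact: c1].
rewrite (_ : k = join_right n j); last exact: val_inj.
rewrite (_ : (fun z => _) =
  fun sw : unit_itv * spx n => \val sw.1 * wt sw.2 j); last first.
  by apply/funext => z; rewrite wt_mixr.
by move=> z; apply: cvgM; [exact: c1|exact: c2].
Qed.

Definition midpoint : unit_itv := clamp 2^-1.

Lemma val_midpoint : \val midpoint = 2^-1.
Proof. by rewrite clampE //; lra. Qed.

Lemma mix_midpoint_gt0 n (w : spx n) :
  (forall i, 0 < wt w i) -> forall i, 0 < wt (mix midpoint w) i.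
Proof.
move=> w0 k; case: (@splitP n.+1 n.+1 k) => j kj.
  rewrite (_ : k = join_left n j); last exact: val_inj.
  by rewrite wt_mixl val_midpoint; have := w0 j; lra.
rewrite (_ : k = join_right n j); last exact: val_inj.
by rewrite wt_mixr val_midpoint; have := w0 j; lra.
Qed.

End refine.

(** * Simplices and prisms as realizations *)
Section inverse.
Context (R : realType).
Notation spx n := (set_type (std_simplex R n)).
Notation unit_itv := (set_type `[0%R : R, 1%R]%classic).
Notation real X := (realization R X).
Notation midpoint := (midpoint R).

(** The maps [phi r d] are the restrictions to cells of a map |D| -> Z.  Its
    injectivity is only assumed on pairs of cells of the same degree and at the
    same positive point; the general case follows by moving two arbitrary
    points to a common refinement.  The inverse is continuous since finitely
    many compact cells cover the Hausdorff space [Z]. *)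
Lemma realization_inverse (D : sset) (Z : topologicalType) (N : nat)
    (phi : forall r : Delta, D r -> spx r -> Z) :
  hausdorff_space Z ->
  (forall r d, continuous (phi r d)) ->
  (forall (m n : Delta) (a : Hom m n) d t,
     phi m (restr D a d) t = phi n d (simplex_push a t)) ->
  (forall r, finite_set [set: D r]) ->
  (forall r d d' w, (forall i, 0 < wt w i) -> phi r d w = phi r d' w -> d = d') ->
  (forall z, exists (r : nat) (d : D r) (w : spx r), (r <= N)%N /\ phi r d w = z) ->
  exists psi : Z -> real D,
    continuous psi /\ forall r d w, psi (phi r d w) = rpoint d w.
Proof.
move=> hZ cphi phiE fD phi_inj phi_surj.
have wd r (d : D r) w r' (d' : D r') w' :
    phi r d w = phi r' d' w' -> rpoint d w = rpoint d' w'.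
  move=> E; have [s [y [a [b [_ y0 ay b_y]]]]] := common_refinement w w'.
  rewrite -ay -b_y -!rpoint_glue; congr rpoint; apply: (phi_inj _ _ _ y) => //.
  by rewrite !phiE ay b_y.
have /choice[psi psiP] : forall z, exists y : real D,
    forall r (d : D r) w, phi r d w = z -> y = rpoint d w.
  move=> z; have [r [d [w [_ E]]]] := phi_surj z; exists (rpoint d w).
  by move=> r' d' w' E'; apply: wd; rewrite E.
have psiE r d w : psi (phi r d w) = rpoint d w by exact: psiP.
exists psi; split=> //.
pose A : set (cell D) := [set c | (projT1 c <= N)%N].
apply: (@compact_cover_continuous Z (real D) (cell D) A
  (fun c => spx (projT1 c)) (fun c => phi _ (projT2 c)) psi) => //.
- rewrite (_ : A = \bigcup_(r in `I_N.+1) ((fun d : D r => existT D r d : cell D) @` setT)).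
    apply: bigcup_finite; first exact: finite_II.
    by move=> r _; apply: finite_image.
  apply/seteqP; split=> [[r d] /= rN|_ [r rN [d _ <-]]] //.
  by exists r => //; exists d.
- by move=> c; exact: spx_compact.
- by move=> c; exact: cphi.
- move=> c; rewrite (_ : _ \o _ = rpoint (projT2 c)); first exact: rpoint_continuous.
  by apply/funext => w; exact: psiE.
- move=> z; have [r [d [w [rN E]]]] := phi_surj z.
  by exists (existT D r d) => //; exists w.
Qed.

Lemma spx_hausdorff n : hausdorff_space (spx n).
Proof.
apply: (@separated_hausdorff R _ _ (fun i t => wt t i)); first exact: wt_continuous.
by move=> t u tu; apply: wt_inj.
Qed.

Program Definition yoneda (n : Delta) : sset :=
  @Presheaf Delta (fun m => @Hom Delta m n) (fun m m' a x => x \oc a) _ _.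
Next Obligation. by move=> n m x; exact: compm1. Qed.
Next Obligation. by move=> n a b c g f x; exact: compmA. Qed.

Program Definition yoneda_map (X : sset) (n : Delta) (x : X n) :
    presheaf_map (yoneda n) X :=
  @PresheafMap Delta (yoneda n) X (fun m a => restr X a x) _.
Next Obligation. by move=> X n x m m' a b; exact: restrM. Qed.

Program Definition sset_prod (X Y : sset) : sset :=
  @Presheaf Delta (fun n => (X n * Y n)%type)
    (fun m n a z => (restr X a z.1, restr Y a z.2)) _ _.
Next Obligation. by move=> X Y n [x y]; rewrite /= !restr1. Qed.
Next Obligation. by move=> X Y m n p b a [x y]; rewrite /= !restrM. Qed.

Program Definition sset_comp (X Y Z : sset) (g : presheaf_map Y Z)
    (f : presheaf_map X Y) : presheaf_map X Z :=
  @PresheafMap Delta X Z (fun n x => g n (f n x)) _.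
Next Obligation. by move=> X Y Z g f m n a x; rewrite /= !naturality. Qed.

Program Definition Sd_map (X Y : sset) (f : presheaf_map X Y) :
    presheaf_map (Sd X) (Sd Y) :=
  @PresheafMap Delta (Sd X) (Sd Y) (fun n => f (dbl n)) _.
Next Obligation. by move=> X Y f m n a x; exact: (naturality f (dbl_map a) x). Qed.

Lemma finite_hom (m n : Delta) : finite_set [set: @Hom Delta m n].
Proof.
pose f (a : @Hom Delta m n) : {ffun 'I_m.+1 -> 'I_n.+1} := finfun a.
rewrite (_ : [set: _] = f @^-1` setT) //; apply: finite_preimage; last exact: finite_finset.
by move=> a b _ _ /ffunP ab; apply: omorphism_eq => i; have := ab i; rewrite !ffunE.
Qed.

(** Cut the interval [0, 1], partitioned according to [t], at its midpoint, and
    rescale the two halves. *)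
Lemma split_at_half (n : nat) (t : spx n) : exists u v : spx n,
  (forall i j, 0 < wt u i -> 0 < wt v j -> (i <= j)%N) /\
  forall k, wt u k + wt v k = 2 * wt t k.
Proof.
(* cum k is the left end of the k-th interval of the partition *)
pose cum (k : nat) : R := \sum_(i < n.+1 | (i < k)%N) wt t i.
have cumS (k : 'I_n.+1) : cum k.+1 = cum k + wt t k.
  rewrite /cum (bigD1 k) //= addrC; congr (_ + _); apply: eq_bigl => i.
  by rewrite ltnS ltn_neqAle andbC.
have cum0 : cum 0%N = 0 by rewrite /cum big_pred0.
have cum1 : cum n.+1 = 1.
  by rewrite -(wt_sum t); apply: eq_bigl => i; rewrite ltn_ord.
have cum_le k l : (k <= l)%N -> cum k <= cum l.
  move=> kl; rewrite /cum [X in X <= _]big_mkcond [X in _ <= X]big_mkcond /=.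
  apply: ler_sum => i _; have := wt_ge0 t i; case: ifP => ik; case: ifP => il //.
  by move: il; rewrite (leq_trans ik kl).
pose h : R := 2^-1.
pose u (i : 'I_n.+1) := 2 * (Num.min (cum i.+1) h - Num.min (cum i) h).
pose v (i : 'I_n.+1) := 2 * (Num.max (cum i.+1) h - Num.max (cum i) h).
have u0 i : 0 <= u i.
  by have := wt_ge0 t i; rewrite /u cumS /Num.min; do 2 case: ifP; lra.
have v0 i : 0 <= v i.
  by have := wt_ge0 t i; rewrite /v cumS /Num.max; do 2 case: ifP; lra.
have u1 : \sum_i u i = 1.
  rewrite -mulr_sumr -(big_mkord xpredT (fun i => Num.min (cum i.+1) h - Num.min (cum i) h)).
  by rewrite telescope_sumr // cum0 cum1 /h min_r ?min_l; lra.
have v1 : \sum_i v i = 1.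
  rewrite -mulr_sumr -(big_mkord xpredT (fun i => Num.max (cum i.+1) h - Num.max (cum i) h)).
  by rewrite telescope_sumr // cum0 cum1 /h [Num.max 1 _]max_l ?[Num.max 0 _]max_r; lra.
exists (mkspx u0 u1), (mkspx v0 v1); split=> [i j|k]; rewrite !wt_mkspx.
  rewrite /u /v => ui vj; rewrite leqNgt; apply/negP => /cum_le ji.
  have := cum_le _ _ (leqnSn i); have := cum_le _ _ (leqnSn j).
  by move: ui vj; rewrite /Num.min /Num.max; do 4 case: ifP; lra.
by rewrite /u /v cumS /Num.min /Num.max; do 2 case: ifP; lra.
Qed.

(** A common refinement of the two halves of [t] has labels that do not decrease
    from the first half to the second, so it is a simplex of the subdivision. *)
Lemma Sd_surj (n : nat) (t : spx n) :
  exists (r : nat) (c : @Hom Delta (dbl r) n) (w : spx r),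
    (r <= n + n + 1)%N /\ simplex_push c (mix midpoint w) = t.
Proof.
have [u [v [uv uvt]]] := split_at_half t.
have [r [w [a [b [rn w0 au bv]]]]] := common_refinement u v.
have push_gt0 (c : @Hom Delta r n) i : 0 < wt (simplex_push c w) (c i).
  rewrite wt_push (bigD1 i) //= ltr_wpDr // sumr_ge0 // => j _; exact: wt_ge0.
have ab i j : (a i <= b j)%N by apply: uv; [rewrite -au|rewrite -bv]; exact: push_gt0.
exists r, (hom_join ab), w; split=> //.
apply: wt_inj => k; rewrite wt_push_mix val_midpoint.
rewrite (_ : hom_join ab \oc join_left r = a); last first.
  by apply: omorphism_eq => i; exact: join_funl.
rewrite (_ : hom_join ab \oc join_right r = b); last first.
  by apply: omorphism_eq => i; exact: join_funr.
by rewrite au bv; have := uvt k; lra.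
Qed.

Lemma mix_midpoint_continuous n : continuous (@mix R n midpoint).
Proof.
move=> w; apply: (@continuous_comp _ _ _
  (fun w : spx n => (midpoint, w)) (fun sw => mix sw.1 sw.2)).
  apply: (@continuous_pair _ _ _ (fun=> midpoint) id).
    exact: cst_continuous.
  by move=> ?; exact: cvg_id.
exact: mix_continuous.
Qed.

Lemma Sd_simplex_inverse (n : nat) : exists psi : spx n -> real (Sd (yoneda n)),
  continuous psi /\
  forall (r : nat) (c : @Hom Delta (dbl r) n) w,
    psi (simplex_push c (mix midpoint w)) = @rpoint R (Sd (yoneda n)) r c w.
Proof.
apply: (@realization_inverse (Sd (yoneda n)) _ (n + n + 1)
  (fun r (c : @Hom Delta (dbl r) n) w => simplex_push c (mix midpoint w))).
- exact: spx_hausdorff.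
- move=> r c w; apply: (@continuous_comp _ _ _ (@mix R r midpoint)).
    exact: mix_midpoint_continuous.
  exact: push_continuous.
- by move=> m p a d t; rewrite -mix_push -push_comp.
- by move=> r; exact: finite_hom.
- by move=> r d d' w w0; apply: push_inj; exact: mix_midpoint_gt0.
- exact: Sd_surj.
Qed.

(** One map for all mixtures: s = 0 gives the first half of a simplex and s = 1/2
    gives the homeomorphism from the subdivision. *)
Lemma mix_homotopy (X : sset) : exists H : real (Sd X) * unit_itv -> real X,
  continuous H /\
  forall (r : nat) (z : X (dbl r)) (w : spx r) s,
    H (@rpoint R (Sd X) r z w, s) = rpoint z (mix s w).
Proof.
have [|H HE] := @realization_lift R (Sd X) (unit_itv -> real X)
  (fun r (z : X (dbl r)) w s => rpoint z (mix s w)).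
  by move=> m n a x t; apply/funext => s; rewrite rpoint_glue mix_push.
exists (fun zs => H zs.1 zs.2); split=> [|r z w s]; last by rewrite HE.
apply: realization_prod_continuous => r z.
rewrite (_ : (fun _ => _) =
  @rpoint R X (dbl r) z \o (fun ws : spx r * unit_itv => mix ws.2 ws.1)).
  move=> ws; apply: continuous_comp; last exact: rpoint_continuous.
  apply: (@continuous_comp _ _ _ (fun ws : spx r * unit_itv => (ws.2, ws.1))
    (fun sw => mix sw.1 sw.2)).
    by apply: continuous_pair => ?; [exact: cvg_snd|exact: cvg_fst].
  exact: mix_continuous.
by apply/funext => ws; rewrite /= HE.
Qed.

Lemma edge_point_subproof0 (s : unit_itv) (i : 'I_2) :
  0 <= if i == ord0 then 1 - \val s else \val s.
Proof.
by have /andP[s0 s1] := unit_itvP s; case: (i == ord0); rewrite ?subr_ge0.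
Qed.

Lemma edge_point_subproof1 (s : unit_itv) :
  \sum_(i < 2) (if i == ord0 then 1 - \val s else \val s) = 1.
Proof. by rewrite big_ord_recl big_ord1 /= subrK. Qed.

Definition edge_point (s : unit_itv) : spx 1 :=
  mkspx (edge_point_subproof0 s) (edge_point_subproof1 s).

Lemma wt_edge_point s i : wt (edge_point s) i = if i == ord0 then 1 - \val s else \val s.
Proof. exact: wt_mkspx. Qed.

Lemma edge_point_continuous : continuous edge_point.
Proof.
apply: spx_continuous => i.
rewrite (_ : (fun z => _) = fun z => if i == ord0 then 1 - \val z else \val z); last first.
  by apply/funext => s; rewrite wt_edge_point.
move=> s; case: (i == ord0); last exact: val_continuous.
apply: (@continuous_comp _ _ _ (fun s : unit_itv => \val s : R) (fun x => 1 - x)).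
  exact: val_continuous.
by apply: cvgB; [exact: cvg_cst|exact: cvg_id].
Qed.

Definition const_hom (n : nat) (b : 'I_2) : @Hom Delta n 1 :=
  @mono_map n 1 (fun=> b) (fun _ _ _ => leqnn b).

Lemma edge_point0 (s : unit_itv) n (t : spx n) :
  \val s = 0 -> edge_point s = simplex_push (const_hom n ord0) t.
Proof.
move=> s0; apply: wt_inj => i; rewrite wt_edge_point wt_push s0 subr0 eq_sym.
by case: eqP => _; rewrite ?wt_sum ?big_pred0.
Qed.

Lemma edge_point1 (s : unit_itv) n (t : spx n) :
  \val s = 1 -> edge_point s = simplex_push (const_hom n ord_max) t.
Proof.
move=> s1; apply: wt_inj => i; rewrite wt_edge_point wt_push s1 subrr.
by case: (unliftP ord0 i) => [j|] ->; rewrite ?(ord1 j) /= ?wt_sum ?big_pred0.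
Qed.

Lemma prism_inverse (n : nat) :
  exists psi : spx n * spx 1 -> real (sset_prod (yoneda n) (yoneda 1%N)),
  continuous psi /\
  forall (r : nat) (a : @Hom Delta r n) (b : @Hom Delta r 1) w,
    psi (simplex_push a w, simplex_push b w) =
    @rpoint R (sset_prod (yoneda n) (yoneda 1%N)) r (a, b) w.
Proof.
have [|r d|m p a d t|r|r [a b] [a' b'] w w0 E|[t u]|psi [cpsi psiE]] :=
  @realization_inverse (sset_prod (yoneda n) (yoneda 1%N))
  (spx n * spx 1)%type (n + 1 + 1)
  (fun r c w => (simplex_push c.1 w, simplex_push c.2 w)).
- apply: (@separated_hausdorff R _ ('I_n.+1 + 'I_2) (fun i tu =>
    match i with inl i => wt tu.1 i | inr i => wt tu.2 i end)) => [[i|i]|[t u] [t' u'] tu].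
  + move=> tu; apply: (@continuous_comp _ _ _ fst (fun t : spx n => wt t i)).
      exact: cvg_fst.
    exact: wt_continuous.
  + move=> tu; apply: (@continuous_comp _ _ _ snd (fun t : spx 1 => wt t i)).
      exact: cvg_snd.
    exact: wt_continuous.
  + by congr pair; apply: wt_inj => i; [exact: (tu (inl i))|exact: (tu (inr i))].
- by apply: continuous_pair; exact: push_continuous.
- by rewrite /= !push_comp.
- by rewrite -setXTT; apply: finite_setX; exact: finite_hom.
- have aa : simplex_push a w = simplex_push a' w := congr1 fst E.
  have bb : simplex_push b w = simplex_push b' w := congr1 snd E.
  by rewrite (push_inj w0 aa) (push_inj w0 bb).
- have [r [w [a [b [rn _ au bv]]]]] := common_refinement t u.
  by exists r, (a, b), w; rewrite /= au bv.
- by exists psi; split=> // r a b w; rewrite -psiE.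
Qed.

Program Definition prism_map (X Y : sset)
    (H : presheaf_map (sset_prod X (yoneda 1%N)) Y) (n : Delta) (x : X n) :
    presheaf_map (sset_prod (yoneda n) (yoneda 1%N)) Y :=
  @PresheafMap Delta (sset_prod (yoneda n) (yoneda 1%N)) Y
    (fun r c => H r (restr X c.1 x, c.2)) _.
Next Obligation.
by move=> X Y H n x m p a c; rewrite -naturality /= -restrM.
Qed.

(** On the prism over each simplex of [X] the homotopy is the realization of
    [prism_map], read through the homeomorphism of [prism_inverse]; a common
    refinement of the point and of the parameter shows that these maps agree
    along faces and degeneracies. *)
Lemma simplicial_homotopy (X Y : sset) (f g : presheaf_map X Y)
    (H : presheaf_map (sset_prod X (yoneda 1%N)) Y) :
  (forall n x, H n (x, const_hom n ord0) = f n x) ->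
  (forall n x, H n (x, const_hom n ord_max) = g n x) ->
  homotopic R (realization_map f : real X -> real Y) (realization_map g).
Proof.
move=> Hf Hg.
have [psi psiP] : exists psi : forall n,
      spx n * spx 1 -> real (sset_prod (yoneda n) (yoneda 1%N)),
    forall n, continuous (psi n) /\
      forall (r : nat) (a : @Hom Delta r n) (b : @Hom Delta r 1) w,
      psi n (simplex_push a w, simplex_push b w) =
      @rpoint R (sset_prod (yoneda n) (yoneda 1%N)) r (a, b) w.
  by exists (fun n => projT1 (cid (prism_inverse n))) => n; exact: (projT2 (cid (prism_inverse n))).
pose Hx n (x : X n) := prism_map H x.
have [|K KE] := @realization_lift R X (unit_itv -> real Y)
  (fun n x t s => realization_map (Hx n x) (psi n (t, edge_point s))).
  move=> m n a x t; apply/funext => s.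
  have [r [w [c [d [_ _ <- <-]]]]] := common_refinement t (edge_point s).
  rewrite -push_comp; have [_ ->] := psiP m; have [_ ->] := psiP n.
  by rewrite !rpoint_map /= restrM.
exists (fun zs => K zs.1 zs.2) => [|z s].
  apply: realization_prod_continuous => n x.
  rewrite (_ : (fun _ => _) = realization_map (Hx n x) \o (psi n \o
    (fun ts : spx n * unit_itv => (ts.1, edge_point ts.2)))); last first.
    by apply/funext => ts; rewrite /= KE.
  move=> ts; apply: continuous_comp; last exact: realization_map_continuous.
  apply: continuous_comp; last by have [+ _] := psiP n; exact.
  apply: continuous_pair => [?|{}ts]; first exact: cvg_fst.
  by apply: (@continuous_comp _ _ _ snd); [exact: cvg_snd|exact: edge_point_continuous].
have [n [x [t ->]]] := rpointP z; rewrite /= KE.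
split=> s01.
  rewrite (edge_point0 t s01) -[X in psi n (X, _)]push_id; have [_ ->] := psiP n.
  by rewrite !rpoint_map /= -Hf restr1.
rewrite (edge_point1 t s01) -[X in psi n (X, _)]push_id; have [_ ->] := psiP n.
by rewrite !rpoint_map /= -Hg restr1.
Qed.

(** The inverse is built simplex by simplex from [Sd_simplex_inverse], and is
    natural because every point of a simplex has the form of [Sd_surj]. *)
Lemma subdivision (X : sset) :
  exists (h : real (Sd X) -> real X) (psi : real X -> real (Sd X)),
  [/\ continuous psi,
      forall (r : nat) (z : X (dbl r)) (w : spx r),
        h (@rpoint R (Sd X) r z w) = rpoint z (mix midpoint w),
      cancel h psi & cancel psi h].
Proof.
have [cell cellP] : exists cell : forall n, spx n -> real (Sd (yoneda n)),
    forall n, continuous (cell n) /\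
      forall (r : nat) (c : @Hom Delta (dbl r) n) w,
      cell n (simplex_push c (mix midpoint w)) = @rpoint R (Sd (yoneda n)) r c w.
  exists (fun n => projT1 (cid (Sd_simplex_inverse n))) => n.
  exact: (projT2 (cid (Sd_simplex_inverse n))).
have [H [_ HE]] := mix_homotopy X.
have [|psi psiE] := @realization_lift R X (real (Sd X))
  (fun n x t => realization_map (Sd_map (yoneda_map x)) (cell n t)).
  move=> m n a x t; have [r [c [w [_ <-]]]] := Sd_surj t.
  rewrite -push_comp; have [_ ->] := cellP m; have [_ ->] := cellP n.
  by rewrite !rpoint_map /= restrM.
have psiP n (x : X n) (r : nat) (c : @Hom Delta (dbl r) n) w :
    psi (rpoint x (simplex_push c (mix midpoint w))) = @rpoint R (Sd X) r (restr X c x) w.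
  by rewrite psiE; have [_ ->] := cellP n; rewrite rpoint_map.
exists (fun z => H (z, midpoint)), psi; split=> [|r z w|z|z]; last 2 first.
- have [r [x [w ->]]] := rpointP z; rewrite HE -[mix _ _]push_id psiP.
  by rewrite restr1.
- have [n [x [t ->]]] := rpointP z; have [r [c [w [_ <-]]]] := Sd_surj t.
  by rewrite psiP HE rpoint_glue.
- apply: realization_continuous => n x.
  rewrite (_ : psi \o _ = realization_map (Sd_map (yoneda_map x)) \o cell n).
    move=> t; apply: continuous_comp; last exact: realization_map_continuous.
    by have [+ _] := cellP n; exact.
  by apply/funext => t; exact: psiE.
- exact: HE.
Qed.

Program Definition Sd_first (X : sset) : presheaf_map (Sd X) X :=
  @PresheafMap Delta (Sd X) X (fun n => restr X (join_left n)) _.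
Next Obligation.
move=> X m n a x /=; rewrite -!restrM; congr (restr X _ x).
by apply: omorphism_eq => i; exact: join_funl.
Qed.

(** Let the mixing parameter run from 0 to 1/2. *)
Lemma first_subdivision (X : sset) (h : real (Sd X) -> real X) :
  (forall (r : nat) (z : X (dbl r)) (w : spx r),
     h (@rpoint R (Sd X) r z w) = rpoint z (mix midpoint w)) ->
  homotopic R (realization_map (Sd_first X) : real (Sd X) -> real X) h.
Proof.
move=> hE; have [H [cH HE]] := mix_homotopy X.
exists (fun zs => H (zs.1, clamp (2^-1 * \val zs.2))).
  apply: (@reparam_continuous R _ _ H (fun s => 2^-1 * s)) => // s.
  by apply: cvgM; [exact: cvg_cst|exact: cvg_id].
move=> z s; have [r [x [w ->]]] := rpointP z; rewrite /= HE.
split=> s01.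
  rewrite (mix0 (n := r)); first by rewrite rpoint_map /= rpoint_glue.
  by rewrite s01 clampE; lra.
by rewrite hE /midpoint s01 mulr1.
Qed.

End inverse.

(** * Equality of arrows and thin categories *)
Section arrows.
Context (C : category).

Definition hom_cast (a a' b b' : C) (ea : a = a') (eb : b = b') (f : Hom a b) :
    Hom a' b' :=
  eq_rect _ (fun x => Hom x b') (eq_rect _ (Hom a) f _ eb) _ ea.

Lemma Arrow_cast (a a' b b' : C) (ea : a = a') (eb : b = b') (f : Hom a b) :
  Arrow (hom_cast ea eb f) = Arrow f.
Proof. by case: _ / ea; case: _ / eb. Qed.

Lemma ArrowP (a a' b b' : C) (f : Hom a b) (f' : Hom a' b') :
  Arrow f = Arrow f' -> exists ea eb, f' = hom_cast ea eb f.
Proof.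
move=> ff'; exists (congr1 (@source C) ff'), (congr1 (@target C) ff').
by apply: Arrow_inj; rewrite Arrow_cast.
Qed.

Lemma Arrow_comp (a b c a' b' c' : C) (g : Hom b c) (f : Hom a b)
    (g' : Hom b' c') (f' : Hom a' b') :
  Arrow g = Arrow g' -> Arrow f = Arrow f' -> Arrow (g \oc f) = Arrow (g' \oc f').
Proof.
move=> gg' /ArrowP[ea [eb ->]].
case: _ / ea; case: _ / eb g' gg' => g' /= /ArrowP[eb [ec ->]].
by rewrite (Prop_irrelevance eb erefl); case: _ / ec.
Qed.

Definition thin := forall (a b : C) (f g : Hom a b), f = g.

Lemma thin_Arrow : thin -> forall (a a' b b' : C) (f : Hom a b) (f' : Hom a' b'),
  a = a' -> b = b' -> Arrow f = Arrow f'.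
Proof. by move=> thC a a' b b' f f' ea eb; subst; rewrite (thC _ _ f f'). Qed.

End arrows.

Lemma fmor_Arrow (C D : category) (F : functor C D) (a a' b b' : C)
    (f : Hom a b) (f' : Hom a' b') :
  Arrow f = Arrow f' -> Arrow (fmor F f) = Arrow (fmor F f').
Proof. by move=> /ArrowP[ea [eb ->]]; case: _ / ea; case: _ / eb. Qed.

Lemma thin_functor_eq (J C : category) (F G : functor J C) :
  thin C -> (forall j, F j = G j) -> F = G.
Proof.
move=> thC FG; apply: functor_arrow_eq => a b f.
by apply: thin_Arrow.
Qed.

Lemma poset_thin d (T : porderType d) : thin (poset_cat T).
Proof. by move=> a b f g; exact: bool_irrelevance. Qed.

Lemma prod_thin (C D : category) : thin C -> thin D -> thin (prod_cat C D).
Proof.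
move=> thC thD [a b] [a' b'] [f g] [f' g'].
by rewrite (thC _ _ f f') (thD _ _ g g').
Qed.

(** * Cartesian arrows and pushforward of diagrams *)
Section cartesian_arrows.
Context (E B : category) (p : functor E B) (hp : is_fibration p).

Lemma cartesian_id (e : E) : cartesian p (idc e).
Proof.
move=> e' g; rewrite fmor1 => pg; exists g; split; first by rewrite compm1.
by move=> h [_ <-]; rewrite compm1.
Qed.

(** In a fibration a cartesian arrow has the lifting property not only for
    vertical arrows: factor through a cartesian arrow over [psi] and use that
    cartesian arrows compose. *)
Lemma cartesian_factor (e e' : E) (l : Hom e e') : cartesian p l ->
  forall (e'' : E) (g : Hom e e'') (psi : Hom (p e') (p e'')),
  fmor p g = psi \oc fmor p l -> exists! h, fmor p h = psi /\ h \oc l = g.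
Proof.
move=> cl e'' g psi gE; have [pre comp] := hp.
have [x [u [cu uE]]] := pre e' (p e'') psi.
have ulE : Arrow (fmor p g) = Arrow (fmor p (u \oc l)).
  by rewrite gE fmorM; apply: Arrow_comp => //; rewrite uE.
have [v [[vE vul] vU]] := comp _ _ _ _ _ cu cl _ _ ulE.
have vu : fmor p (v \oc u) = psi.
  apply: Arrow_inj; rewrite fmorM -[in RHS](comp1m psi).
  apply: Arrow_comp => //; rewrite vE.
  by have := congr1 (@target _) uE => /= ->.
exists (v \oc u); split; first by split=> //; rewrite -compmA.
move=> h [hE hl].
have [|v' [[v'E v'u] _]] := cu e'' h; first by rewrite hE uE.
rewrite -v'u; congr (_ \oc _); apply: vU; split=> //.
by rewrite compmA v'u.
Qed.

Lemma cartesian_epi (e e' e'' : E) (l : Hom e e') (h h' : Hom e' e'') :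
  cartesian p l -> fmor p h = fmor p h' -> h \oc l = h' \oc l -> h = h'.
Proof.
move=> cl hh' hl.
have [|k [_ kU]] := cartesian_factor cl (g := h \oc l) (psi := fmor p h); first exact: fmorM.
by rewrite -(kU h) // -(kU h').
Qed.

Lemma cartesian_cancel (e e' e'' : E) (l : Hom e e') (h : Hom e' e'') :
  cartesian p l -> cartesian p (h \oc l) -> cartesian p h.
Proof.
move=> cl chl x g gh.
have [|v [[vE vhl] vU]] := chl x (g \oc l).
  by rewrite !fmorM; exact: Arrow_comp.
exists v; split=> [|v' [v'E v'h]]; last first.
  by apply: vU; split=> //; rewrite compmA v'h.
split=> //; apply: (cartesian_epi cl); last by rewrite -compmA.
apply: Arrow_inj; rewrite gh fmorM -[RHS](congr1 Arrow (comp1m _)).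
exact: Arrow_comp.
Qed.

(** The choice is normalised: over an identity the chosen arrow is an identity.
    The homotopies below start or end strictly at the required maps thanks to
    this. *)
Lemma cleavage_ex (e : E) (b : B) (phi : Hom (p e) b) :
  exists u : {e' : E & Hom e e'},
    [/\ cartesian p (projT2 u), Arrow (fmor p (projT2 u)) = Arrow phi &
        Arrow phi = Arrow (idc (p e)) -> Arrow (projT2 u) = Arrow (idc e)].
Proof.
have [phi1|phi1] := pselect (Arrow phi = Arrow (idc (p e))).
  exists (existT _ e (idc e)); split=> //=; first exact: cartesian_id.
  by rewrite fmor1.
have [e' [l [cl lE]]] := hp.1 e b phi.
by exists (existT _ e' l).
Qed.

Definition cleavage (e : E) (b : B) (phi : Hom (p e) b) : {e' : E & Hom e e'} :=
  projT1 (cid (cleavage_ex phi)).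

Definition push_ob (e : E) (b : B) (phi : Hom (p e) b) : E := projT1 (cleavage phi).

Definition push_arrow (e : E) (b : B) (phi : Hom (p e) b) : Hom e (push_ob phi) :=
  projT2 (cleavage phi).

Lemma push_arrow_cartesian e b (phi : Hom (p e) b) : cartesian p (push_arrow phi).
Proof. by have [] := projT2 (cid (cleavage_ex phi)). Qed.

Arguments push_arrow_cartesian {e b} phi.

Lemma push_arrow_over e b (phi : Hom (p e) b) : Arrow (fmor p (push_arrow phi)) = Arrow phi.
Proof. by have [] := projT2 (cid (cleavage_ex phi)). Qed.

Lemma push_arrow_normal e b (phi : Hom (p e) b) :
  Arrow phi = Arrow (idc (p e)) -> Arrow (push_arrow phi) = Arrow (idc e).
Proof. by have [] := projT2 (cid (cleavage_ex phi)). Qed.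

(** A diagram [e] in E, with a natural transformation [phi] from its projection
    to a diagram [c] in B, is pushed forward to a diagram over [c]. *)
Section pushforward.
Context (J : category) (e : functor J E) (c : functor J B)
  (phi : forall j, Hom (p (e j)) (c j)).
Hypothesis phi_nat : forall i j (f : Hom i j),
  fmor c f \oc phi i = phi j \oc fmor p (fmor e f).

Lemma push_ob_over j : p (push_ob (phi j)) = c j.
Proof. exact: (congr1 (@target _) (push_arrow_over (phi j))). Qed.

Definition over_mor i j (f : Hom i j) :
    Hom (p (push_ob (phi i))) (p (push_ob (phi j))) :=
  hom_cast (esym (push_ob_over i)) (esym (push_ob_over j)) (fmor c f).

Lemma push_mor_ex i j (f : Hom i j) :
  exists! h : Hom (push_ob (phi i)) (push_ob (phi j)),
    fmor p h = over_mor f /\ h \oc push_arrow (phi i) = push_arrow (phi j) \oc fmor e f.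
Proof.
apply: cartesian_factor; first exact: push_arrow_cartesian.
apply: Arrow_inj; rewrite fmorM.
rewrite (_ : Arrow (over_mor f \oc _) = Arrow (fmor c f \oc phi i)).
  by rewrite phi_nat; apply: Arrow_comp => //; exact: push_arrow_over.
by apply: Arrow_comp; [exact: Arrow_cast|exact: push_arrow_over].
Qed.

Definition push_mor i j (f : Hom i j) : Hom (push_ob (phi i)) (push_ob (phi j)) :=
  projT1 (cid (push_mor_ex f)).

Lemma push_mor_over i j (f : Hom i j) : Arrow (fmor p (push_mor f)) = Arrow (fmor c f).
Proof.
by have [[pE _] _] := projT2 (cid (push_mor_ex f)); rewrite pE Arrow_cast.
Qed.

Lemma push_mor_arrow i j (f : Hom i j) :
  push_mor f \oc push_arrow (phi i) = push_arrow (phi j) \oc fmor e f.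
Proof. by have [[_ pE] _] := projT2 (cid (push_mor_ex f)). Qed.

Lemma push_mor_unique i j (f : Hom i j) (h : Hom (push_ob (phi i)) (push_ob (phi j))) :
  Arrow (fmor p h) = Arrow (fmor c f) ->
  h \oc push_arrow (phi i) = push_arrow (phi j) \oc fmor e f -> push_mor f = h.
Proof.
move=> hE hl; refine (cartesian_epi (push_arrow_cartesian (phi i)) _ _).
  by apply: Arrow_inj; rewrite push_mor_over.
by rewrite push_mor_arrow.
Qed.

Program Definition pushforward : functor J E :=
  @Functor J E (fun j => push_ob (phi j)) push_mor _ _.
Next Obligation.
move=> i; apply: push_mor_unique; rewrite !fmor1 ?push_ob_over //.
by rewrite compm1 comp1m.
Qed.
Next Obligation.
move=> i j k g f; apply: push_mor_unique.
  by rewrite !fmorM; apply: Arrow_comp; exact: push_mor_over.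
by rewrite -compmA push_mor_arrow compmA push_mor_arrow -compmA fmorM.
Qed.

Lemma pushforward_over : p \oF pushforward = c.
Proof. by apply: functor_arrow_eq => i j f; exact: push_mor_over. Qed.

(** The square formed with the chosen arrows, which are cartesian, commutes, and
    cartesian arrows can be cancelled on the right. *)
Lemma pushforward_cartesian i j (f : Hom i j) :
  cartesian p (fmor e f) -> cartesian p (fmor pushforward f).
Proof.
move=> cf; refine (cartesian_cancel (push_arrow_cartesian (phi i)) _).
by rewrite /= push_mor_arrow; apply: hp.2 => //; exact: push_arrow_cartesian.
Qed.

Lemma pushforward_id :
  (forall j, Arrow (phi j) = Arrow (idc (p (e j)))) -> pushforward = e.
Proof.
move=> phi1; apply: functor_arrow_eq => i j f /=.
have l1 k : Arrow (push_arrow (phi k)) = Arrow (idc (e k)) := push_arrow_normal (phi1 k).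
have ob k : push_ob (phi k) = e k := congr1 (@target _) (l1 k).
rewrite -[push_mor f]compm1 -[fmor e f]comp1m -(Arrow_comp (l1 j) (erefl _)) -push_mor_arrow.
apply: Arrow_comp => //; rewrite l1.
exact: (congr1 (fun x => Arrow (idc x)) (ob i)).
Qed.

End pushforward.

Lemma pushforward_eq (J : category) (e e' : functor J E) (c c' : functor J B)
    phi phi' nphi nphi' :
  e = e' -> c = c' -> (forall j, Arrow (phi j) = Arrow (phi' j)) ->
  @pushforward J e c phi nphi = @pushforward J e' c' phi' nphi'.
Proof.
move=> ee' cc'; subst e' c' => pp'.
have pp : phi = phi' by apply/functional_extensionality_dep => j; exact: Arrow_inj.
by subst phi'; rewrite (Prop_irrelevance nphi nphi').
Qed.

Lemma pushforward_comp (J K : category) (e : functor J E) (c : functor J B)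
    phi nphi (k : functor K J) nphi' :
  @pushforward J e c phi nphi \oF k =
  @pushforward K (e \oF k) (c \oF k) (fun j => phi (k j)) nphi'.
Proof.
apply: functor_eq => i j f; apply: esym.
exact: (@push_mor_unique K (e \oF k) (c \oF k) (fun j => phi (k j)) nphi' i j f
  (push_mor nphi (fmor k f)) (push_mor_over nphi _) (push_mor_arrow nphi _)).
Qed.

(** All pushforwards below arise from a diagram [s] of thin shape, restricted along
    [al] and pushed over its restriction along [al'], where [al] is below [al'].
    Naturality is automatic for thin shapes, and so is compatibility with
    changes of shape ([transport_comp]). *)
Section transport.
Context (C J : category) (thC : thin C) (s : functor C E)
  (al al' : functor J C) (eta : forall j, Hom (al j) (al' j)).

Lemma transport_nat i j (f : Hom i j) :
  fmor (p \oF s \oF al') f \oc fmor p (fmor s (eta i)) =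
  fmor p (fmor s (eta j)) \oc fmor p (fmor (s \oF al) f).
Proof. by rewrite /= -!fmorM; congr (fmor p (fmor s _)); exact: thC. Qed.

Definition transport : functor J E :=
  @pushforward J (s \oF al) (p \oF s \oF al') _ transport_nat.

Lemma transport_over : p \oF transport = p \oF s \oF al'.
Proof. exact: pushforward_over. Qed.

Lemma transport_id : al = al' -> transport = s \oF al.
Proof.
move=> aa'; apply: pushforward_id => j.
have Earr : Arrow (eta j) = Arrow (idc (al j)) by apply: thin_Arrow => //; rewrite aa'.
by rewrite (fmor_Arrow p (fmor_Arrow s Earr)) !fmor1.
Qed.

End transport.

Lemma transport_comp (C J C' J' : category) (thC : thin C) (thC' : thin C')
    (s : functor C E) (al al' : functor J C) eta (g : functor C' C)
    (k : functor J' J) (be be' : functor J' C') theta :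
  g \oF be = al \oF k -> g \oF be' = al' \oF k ->
  @transport C' J' thC' (s \oF g) be be' theta =
  @transport C J thC s al al' eta \oF k.
Proof.
move=> gb gb'; rewrite /transport pushforward_comp => [i j f|H].
  exact: (transport_nat thC s eta (fmor k f)).
apply: pushforward_eq => [||j].
- by rewrite -!comp_functorA gb.
- by rewrite -!comp_functorA gb'.
- have Earr : Arrow (fmor g (theta j)) = Arrow (eta (k j)).
    apply: thin_Arrow => //; first exact: (congr1 (fun F : functor _ _ => F j) gb).
    exact: (congr1 (fun F : functor _ _ => F j) gb').
  exact: (fmor_Arrow p (fmor_Arrow s Earr)).
Qed.

End cartesian_arrows.

(** * The simplicial maps and homotopies *)
Lemma switch_mono (n : nat) (b : @Hom Delta n 1) (i j : 'I_n.+1) :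
  (i <= j)%N ->
  ((if b i == ord0 then join_left n i else join_right n i) <=
   (if b j == ord0 then join_left n j else join_right n j))%N.
Proof.
move=> ij; case: eqP => bi; case: eqP => bj.
- exact: hom_mono.
- exact: join_left_right.
- case: bi; apply/val_inj/eqP; rewrite -leqn0.
  by have := hom_mono b ij; rewrite bj.
- exact: hom_mono.
Qed.

(** The embedding of [n] in the join of two copies of it that uses the first
    copy where [b] is 0 and the second copy where [b] is 1. *)
Definition switch (n : nat) (b : @Hom Delta n 1) : @Hom Delta n (dbl n) :=
  mono_map (@switch_mono n b).

Lemma switch0 n : switch (const_hom n ord0) = join_left n.
Proof. exact: omorphism_eq. Qed.

Lemma switch1 n : switch (const_hom n ord_max) = join_right n.
Proof. exact: omorphism_eq. Qed.

Lemma dbl_map_left (m n : nat) (a : @Hom Delta m n) :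
  dbl_map a \oc join_left m = join_left n \oc a.
Proof. by apply: omorphism_eq => i; exact: join_funl. Qed.

Lemma dbl_map_right (m n : nat) (a : @Hom Delta m n) :
  dbl_map a \oc join_right m = join_right n \oc a.
Proof. by apply: omorphism_eq => i; exact: join_funr. Qed.

Lemma dbl_map_switch (m n : nat) (a : @Hom Delta m n) (b : @Hom Delta n 1) :
  dbl_map a \oc switch (b \oc a : @Hom Delta m 1) = switch b \oc a.
Proof.
apply: omorphism_eq => i /=; case: ifP => _; [exact: join_funl|exact: join_funr].
Qed.

Lemma join_left_switch (n : nat) (b : @Hom Delta n 1) i : (join_left n i <= switch b i)%N.
Proof. by rewrite [switch b i]/=; case: ifP => _ //; exact: join_left_right. Qed.

Lemma ord_thin n : thin (ord_cat n).
Proof. exact: poset_thin. Qed.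

Notation grid n := (prod_cat (ord_cat n) (ord_cat n)).

Lemma grid_thin n : thin (grid n).
Proof. exact: prod_thin (ord_thin (n:=n)) (ord_thin (n:=n)). Qed.

Definition pr1_functor (C D : category) : functor (prod_cat C D) C :=
  @Functor (prod_cat C D) C fst (fun x y f => f.1)
    (fun=> erefl) (fun _ _ _ _ _ => erefl).

Section comparison.
Context (E B : category) (p : functor E B) (hp : is_fibration p).
Notation xi := (Fibration hp).
Notation NE := (nerve E).
Notation dN := (diag_sset (fibred_nerve xi)).

Lemma thin_cartesian (C : category) (thC : thin C) (s : functor C E)
    (x y : C) (f : Hom x y) : x = y -> cartesian p (fmor s f).
Proof.
move=> xy; subst y; rewrite (thC _ _ f (idc x)) fmor1; exact: cartesian_id.
Qed.

Definition spread_source n : functor (grid n) (ord_cat (dbl n)) :=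
  ord_functor (join_left n) \oF pr1_functor _ _.
Definition spread_target n : functor (grid n) (ord_cat (dbl n)) :=
  ord_functor (join_right n) \oF pr2_functor _ _.

(** At (a, b), the pushforward of z(a) over p(z(b')), with a in the first copy of
    [n] and b' in the second. *)
Definition spread_total n (z : functor (ord_cat (dbl n)) E) : functor (grid n) E :=
  transport hp (ord_thin (n:=dbl n)) z
    (al := spread_source n) (al' := spread_target n) (fun x => join_left_right x.1 x.2).

Program Definition spread_cell n (z : functor (ord_cat (dbl n)) E) :
    fibred_map (square_fib n n) xi :=
  @FibredMap (square_fib n n) xi (spread_total z)
    (p \oF z \oF ord_functor (join_right n)) _ _.
Next Obligation. by move=> n z; rewrite /= /spread_total transport_over comp_functorA. Qed.
Next Obligation.
move=> n z x y f /cartesian_pr2 xy; apply: pushforward_cartesian => /=.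
by apply: (thin_cartesian (@ord_thin (dbl n))); rewrite /= xy.
Qed.

Program Definition spread : presheaf_map (Sd NE) dN :=
  @PresheafMap Delta (Sd NE) dN spread_cell _.
Next Obligation.
move=> m n a z; apply: fibred_map_eq => /=.
  apply: transport_comp; apply: thin_functor_eq (ord_thin (n:=_)) _ => x.
    exact: join_funl.
  exact: join_funr.
by rewrite -!comp_functorA -!ord_functorM dbl_map_right.
Qed.

Definition push_toward n (z : functor (ord_cat (dbl n)) E) (b : @Hom Delta n 1) :
    functor (ord_cat n) E :=
  transport hp (ord_thin (n:=dbl n)) z
    (al := ord_functor (join_left n)) (al' := ord_functor (switch b)) (join_left_switch b).

(** Where [b] is 0 the chain z is left alone, since the cleavage is normalised;
    where [b] is 1 it is replaced by the pushforward of z(a) over p(z(a')). *)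
Program Definition push_homotopy :
    presheaf_map (sset_prod (Sd NE) (yoneda 1%N)) NE :=
  @PresheafMap Delta (sset_prod (Sd NE) (yoneda 1%N)) NE
    (fun n zb => push_toward zb.1 zb.2) _.
Next Obligation.
move=> m n a [z b]; apply: transport_comp; rewrite -!ord_functorM.
  by rewrite dbl_map_left.
by rewrite dbl_map_switch.
Qed.

Lemma push_homotopy0 n (z : Sd NE n) :
  push_homotopy n (z, const_hom n ord0) = Sd_first NE n z.
Proof. by apply: transport_id; rewrite switch0. Qed.

Lemma push_homotopy1 n (z : Sd NE n) :
  push_homotopy n (z, const_hom n ord_max) =
  sset_comp (diag_nerve_map xi) spread n z.
Proof.
rewrite /= /push_toward -[z in LHS]comp_functor1; apply: transport_comp.
  by apply: thin_functor_eq (ord_thin (n:=_)) _.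
by rewrite switch1; apply: thin_functor_eq (ord_thin (n:=_)) _.
Qed.

Definition bi_restr n (a b : @Hom Delta n (dbl n)) (s : Sd dN n) : dN n :=
  restr (fibred_nerve xi) ((a, b) : @Hom (prod_cat Delta Delta) (n, n) (dbl n, dbl n)) s.

Lemma bi_restr_natural (m n : Delta) (a : Hom m n) b b' c c' (s : Sd dN n) :
  dbl_map a \oc b' = b \oc a -> dbl_map a \oc c' = c \oc a ->
  bi_restr b' c' (restr (Sd dN) a s) = restr dN a (bi_restr b c s).
Proof.
move=> bE cE; pose K := fibred_nerve xi.
pose bc : @Hom (prod_cat Delta Delta) (n, n) (dbl n, dbl n) := (b, c).
pose bc' : @Hom (prod_cat Delta Delta) (m, m) (dbl m, dbl m) := (b', c').
pose aa : @Hom (prod_cat Delta Delta) (m, m) (n, n) := (a, a).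
pose daa : @Hom (prod_cat Delta Delta) (dbl m, dbl m) (dbl n, dbl n) :=
  (dbl_map a, dbl_map a).
have E2 : daa \oc bc' = bc \oc aa by congr pair.
rewrite -[LHS]/(restr K bc' (restr K daa s)) -[RHS]/(restr K aa (restr K bc s)).
by rewrite -!restrM E2.
Qed.

(** The square s restricted to the first copy of [n] vertically and to the second
    one horizontally: the common end of the next two homotopies. *)
Program Definition mixed : presheaf_map (Sd dN) dN :=
  @PresheafMap Delta (Sd dN) dN (fun n => bi_restr (join_left n) (join_right n)) _.
Next Obligation.
move=> m n a s; apply: bi_restr_natural; first exact: dbl_map_left.
exact: dbl_map_right.
Qed.

Program Definition horizontal_homotopy :
    presheaf_map (sset_prod (Sd dN) (yoneda 1%N)) dN :=
  @PresheafMap Delta (sset_prod (Sd dN) (yoneda 1%N)) dN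
    (fun n sb => bi_restr (join_left n) (switch sb.2) sb.1) _.
Next Obligation.
move=> m n a [s b]; apply: bi_restr_natural; first exact: dbl_map_left.
exact: dbl_map_switch.
Qed.

Lemma horizontal_homotopy0 n (s : Sd dN n) :
  horizontal_homotopy n (s, const_hom n ord0) = Sd_first dN n s.
Proof. by rewrite /= switch0. Qed.

Lemma horizontal_homotopy1 n (s : Sd dN n) :
  horizontal_homotopy n (s, const_hom n ord_max) = mixed n s.
Proof. by rewrite /= switch1. Qed.

(** The vertex (a, a) where [b] is 0 and (a, b') where [b] is 1, in a square with
    sides cut in two; all these vertices are below (a, b'), in the same row. *)
Definition corner_ob n (b : @Hom Delta n 1) (x : grid n) : grid (dbl n) :=
  (join_left n x.1, if b x.2 == ord0 then join_left n x.1 else join_right n x.2).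

Lemma corner_mono n (b : @Hom Delta n 1) (x y : grid n) (f : Hom x y) :
  ((corner_ob b x).2 <= (corner_ob b y).2)%N.
Proof.
case: f => xy1 xy2 /=; case: eqP => bx; case: eqP => bY //.
- exact: (join_left_right x.1 y.2).
- case: bx; apply/val_inj/eqP; rewrite -leqn0.
  by have := hom_mono b xy2; rewrite bY.
- exact: (hom_mono (join_right n) xy2).
Qed.

Definition corner n (b : @Hom Delta n 1) : functor (grid n) (grid (dbl n)) :=
  @Functor (grid n) (grid (dbl n)) (corner_ob b)
    (fun x y f => (hom_mono (join_left n) f.1, corner_mono b f))
    (fun _ => grid_thin _ _) (fun _ _ _ _ _ => grid_thin _ _).

Definition corner_end n : functor (grid n) (grid (dbl n)) :=
  prod_functor (ord_functor (join_left n)) (ord_functor (join_right n)).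

Lemma corner_le n (b : @Hom Delta n 1) (x : grid n) :
  ((corner b x).2 <= (corner_end n x).2)%N.
Proof. by rewrite /=; case: ifP => _ //; exact: (join_left_right x.1 x.2). Qed.

Definition corner_hom n (b : @Hom Delta n 1) (x : grid n) :
    Hom (corner b x) (corner_end n x) :=
  (leqnn _, corner_le b x).

Lemma fm_over k l (s : fibred_map (square_fib k l) xi)
    (x y : prod_cat (ord_cat k) (ord_cat l)) (f : Hom x y) :
  Arrow (fmor p (fmor (fm_total s) f)) = Arrow (fmor (fm_base s) f.2).
Proof. exact: (congr1 (fun F : functor _ _ => Arrow (fmor F f)) (fm_comm s)). Qed.

Definition corner_total n (s : fibred_map (square_fib (dbl n) (dbl n)) xi)
    (b : @Hom Delta n 1) : functor (grid n) E :=
  transport hp (grid_thin (n:=dbl n)) (fm_total s) (corner_hom b).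

Program Definition corner_cell n (s : fibred_map (square_fib (dbl n) (dbl n)) xi)
    (b : @Hom Delta n 1) : fibred_map (square_fib n n) xi :=
  @FibredMap (square_fib n n) xi (corner_total s b)
    (fm_base s \oF ord_functor (join_right n)) _ _.
Next Obligation.
move=> n s b; rewrite /= /corner_total transport_over.
by apply: functor_arrow_eq => x y f; exact: fm_over.
Qed.
Next Obligation.
move=> n s b x y f /cartesian_pr2 xy; apply: pushforward_cartesian.
by apply: (@fm_cart _ _ s _ _ (fmor (corner b) f)); apply/cartesian_pr2; rewrite /= xy.
Qed.

(** Push s(a,a), or s(a,b'), over the base point of s(a,b').  In the second case
    nothing moves.  In both cases a horizontal arrow of the grid goes to an arrow
    that stays in the row a, hence is cartesian in E, and so is its
    pushforward. *)
Program Definition corner_homotopy :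
    presheaf_map (sset_prod (Sd dN) (yoneda 1%N)) dN :=
  @PresheafMap Delta (sset_prod (Sd dN) (yoneda 1%N)) dN
    (fun n sb => corner_cell sb.1 sb.2) _.
Next Obligation.
move=> m n a [s b]; apply: fibred_map_eq => /=; last first.
  by rewrite -!comp_functorA -!ord_functorM dbl_map_right.
apply: transport_comp; apply: thin_functor_eq (grid_thin (n:=_)) _ => x.
  congr pair; first exact: join_funl.
  by rewrite /=; case: ifP => _; [exact: join_funl|exact: join_funr].
by congr pair; [exact: join_funl|exact: join_funr].
Qed.

(** Here s(a,a) is pushed over the base point of s(b',b') on one side and of
    s(a,b') on the other; these agree because the projection of a fibred square
    depends on the horizontal coordinate only. *)
Lemma corner_homotopy0 n (s : Sd dN n) :
  corner_homotopy n (s, const_hom n ord0) =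
  sset_comp spread (Sd_map (diag_nerve_map xi)) n s.
Proof.
apply: fibred_map_eq => /=; last first.
  by apply: functor_arrow_eq => x y f; rewrite /= fm_over.
apply: pushforward_eq => [||x].
- rewrite -comp_functorA; congr (_ \oF _).
  by apply: thin_functor_eq (grid_thin (n:=_)) _.
- by apply: functor_arrow_eq => x y f; rewrite /= !fm_over.
- rewrite /= !fm_over; apply: fmor_Arrow.
  by apply: (thin_Arrow (@ord_thin (dbl n))).
Qed.

Lemma corner_homotopy1 n (s : Sd dN n) :
  corner_homotopy n (s, const_hom n ord_max) = mixed n s.
Proof.
apply: fibred_map_eq => //=.
rewrite /corner_total transport_id; last exact: thin_functor_eq (grid_thin (n:=_)) _.
by congr (_ \oF _); apply: thin_functor_eq (grid_thin (n:=_)) _.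
Qed.

End comparison.

Lemma realization_map_comp (R : realType) (X Y Z : sset)
    (g : presheaf_map Y Z) (f : presheaf_map X Y) :
  (realization_map (sset_comp g f) : realization R X -> realization R Z) =
  realization_map g \o realization_map f.
Proof.
by apply/funext => z; have [n [x [t ->]]] := rpointP z; rewrite /= !rpoint_map.
Qed.

Lemma homotopic_eq (R : realType) (S T : topologicalType) (f f' g g' : S -> T) :
  f =1 f' -> g =1 g' -> homotopic R f g -> homotopic R f' g'.
Proof. by move=> /funext-> /funext->. Qed.

Theorem mainTheorem4 (R : realType) (E B : category) (p : functor E B)
    (hp : is_fibration p) :
  weak_equivalence R (diag_nerve_map (Fibration hp)).
Proof.
set xi := Fibration hp; set k := diag_nerve_map xi.
pose NE := nerve E; pose dN := diag_sset (fibred_nerve xi).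
have [hE [psiE [cpsiE hEE hpE phE]]] := subdivision R NE.
have [hN [psiN [cpsiN hNE hpN phN]]] := subdivision R dN.
(* naturality of the subdivision homeomorphism along k *)
have kh z : hE (realization_map (Sd_map k) z) = realization_map k (hN z).
  have [n [x [t ->]]] := rpointP z.
  by rewrite hNE !rpoint_map hEE.
split; first exact: realization_map_continuous.
exists (realization_map (spread hp) \o psiE); split.
- move=> z; apply: continuous_comp; first exact: cpsiE.
  exact: realization_map_continuous.
- have H1 := simplicial_homotopy R (@corner_homotopy0 E B p hp) (@corner_homotopy1 E B p hp).
  have H2 := simplicial_homotopy R (@horizontal_homotopy0 E B p hp)
    (@horizontal_homotopy1 E B p hp).
  have H3 := first_subdivision hNE.
  have H := homotopic_trans H1 (homotopic_trans (homotopic_sym H2) H3).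
  apply: homotopic_eq (homotopic_precomp cpsiN H) => z; last exact: phN.
  rewrite realization_map_comp /=; congr (realization_map _ _).
  by rewrite -[LHS]hpE kh phN.
- have H1 := simplicial_homotopy R (@push_homotopy0 E B p hp) (@push_homotopy1 E B p hp).
  have H2 := first_subdivision hEE.
  have H := homotopic_trans (homotopic_sym H1) H2.
  apply: homotopic_eq (homotopic_precomp cpsiE H) => z; last exact: phE.
  by rewrite realization_map_comp.
Qed.
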